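(* Let $\overline{M}\times_F\widetilde{N}$ be the warped product manifold of a $2$-dimensional semi-Riemannian manifold $(\overline{M},\overline{g})$ and an $(n-2)$-dimensional semi-Riemannian manifold $(\widetilde{N},\widetilde{g})$, $n\geq4$, with warping function $F$, and assume that $(\widetilde{N},\widetilde{g})$ is an Einstein manifold if $n\geq5$ (no assumption on $(\widetilde N,\widetilde g)$ if $n=4$). Then on ${\mathcal U}_S\subset\overline{M}\times_F\widetilde{N}$ we have $$\mathrm{rank}(S-\tau_1\,g)\leq2,\qquad \tau_1=\frac{\widetilde\kappa}{(n-2)F}-\frac{\mathrm{tr}(T)}{2F}-(n-3)\frac{\Delta_1F}{4F^2}.$$ Moreover, if $\mathrm{rank}(S-\tau_1\,g)=2$ on some open non-empty subset of ${\mathcal U}_S$, then $\overline{M}\times_F\widetilde{N}$ is a $2$-quasi-Einstein manifold.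
   Context: All manifolds are connected, paracompact and of class $C^\infty$. $S$ and $\kappa$ denote the Ricci tensor $S(X,Y)=\mathrm{tr}\{Z\mapsto{\mathcal R}(Z,X)Y\}$, where ${\mathcal R}(X,Y)Z=\nabla_X\nabla_YZ-\nabla_Y\nabla_XZ-\nabla_{[X,Y]}Z$, and the scalar curvature of a semi-Riemannian manifold $(M,g)$, $n=\dim M$. ${\mathcal U}_S$ is the set of points of $M$ where $S\ne\frac{\kappa}{n}g$; $(M,g)$ is Einstein if $S=\frac\kappa n g$ on $M$. $(M,g)$, $n\ge3$, is a $2$-quasi-Einstein manifold if for some function $\alpha$ on ${\mathcal U}_S$ we have $\mathrm{rank}(S-\alpha g)\le2$ on ${\mathcal U}_S$ and $\mathrm{rank}(S-\alpha g)=2$ on some open non-empty subset of ${\mathcal U}_S$. Warped product: $F$ is a positive smooth function on $\overline M$ and $g=\pi_1^*\overline g+(F\circ\pi_1)\,\pi_2^*\widetilde g$ on $\overline M\times\widetilde N$. In product charts, indices $a,b\in\{1,2\}$ refer to $\overline M$; $T_{ab}=\overline\nabla_aF_b-\frac1{2F}F_aF_b$, $F_a=\partial_aF$, $\mathrm{tr}(T)=\overline g^{ab}T_{ab}$, $\Delta_1F=\overline g^{ab}F_aF_b$; $\widetilde\kappa$ is the scalar curvature of $(\widetilde N,\widetilde g)$. Functions on the factors are regarded as functions on the product. *)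

(* Defs.v *)
From HB Require Import structures.
From mathcomp Require Import all_boot all_order all_algebra.
From mathcomp Require Import boolp classical_sets functions cardinality.
From mathcomp Require Import reals interval_inference topology normedtype derive.

Set Implicit Arguments.
Unset Strict Implicit.
Unset Printing Implicit Defensive.

Import Order.TTheory GRing.Theory Num.Theory.
Import numFieldNormedType.Exports.

Local Open Scope classical_set_scope.
Local Open Scope ring_scope.

Definition paracompact (T : topologicalType) : Prop :=
  forall U : set (set T),
    (forall u, U u -> open u) -> (forall x : T, exists2 u, U u & u x) ->
    exists V : set (set T),
      [/\ forall v, V v -> open v,
          forall x, exists2 v, V v & v x,
          forall v, V v -> exists2 u, U u & v `<=` u
        & forall x : T, exists2 W : set T, nbhs x W &
            finite_set [set v | V v /\ v `&` W !=set0]].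

Section Topology.
Implicit Types S T : topologicalType.

(* A property of subsets that is hereditary, stable under binary unions and
   holds near each point of a compact set holds for this compact set. *)
Lemma compact_local_ind T (K : set T) (P : set T -> Prop) :
  compact K -> P set0 -> (forall A B, A `<=` B -> P B -> P A) ->
  (forall A B, P A -> P B -> P (A `|` B)) ->
  (forall x, K x -> exists2 U, nbhs x U & P U) -> P K.
Proof.
move=> cK P0 Pmono PU Ploc; apply: contrapT => nPK.
pose F : set_system T := [set A | P (K `\` A)].
have FF : ProperFilter F.
  split; first by rewrite /F /= setD0.
  split.
  - by rewrite /F /= setDT.
  - by move=> A B FA FB; rewrite /F /= setDIr; exact: PU.
  - by move=> A B AB; apply: Pmono; exact: setDS.
have [x [Kx clx]] : K `&` cluster F !=set0.
  by apply: cK; rewrite /F /= setDv.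
have [U nU PUx] := Ploc x Kx.
have FU : F (~` U) by rewrite /F /= setDE setCK; apply: Pmono PUx => y [].
by have [y [nUy Uy]] := clx _ _ FU nU.
Qed.

Definition locally_cpt T := forall x : T, exists2 K, compact K & nbhs x K.

Definition exhaustible T := exists K : nat -> set T,
  [/\ forall n, compact (K n), forall n, K n `<=` (K n.+1)^°
    & forall x, exists n, K n x].

Lemma finite_bigcup_compact T (V : set (set T)) (C : set T -> set T) :
  finite_set V -> (forall v, V v -> compact (C v)) ->
  compact (\bigcup_(v in V) C v).
Proof.
move=> /finite_seqP [s ->]; elim: s => [|v s IH] cC.
  by rewrite set_nil bigcup_set0; exact: compact0.
rewrite (_ : [set` v :: s] = v |` [set` s]); last first.
  apply/seteqP; split=> w /=; rewrite in_cons.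
    by case/orP=> [/eqP ->|]; [left|right].
  by case=> [->|ws]; [rewrite eqxx|rewrite [w \in s]ws orbT].
rewrite bigcup_setU1; apply: compactU.
  by apply: cC; rewrite /= mem_head.
by apply: IH => w /= ws; apply: cC; rewrite /= in_cons ws orbT.
Qed.

Lemma paracompact_exhaustible T :
  connected [set: T] -> paracompact T -> locally_cpt T -> exhaustible T.
Proof.
move=> conT parT lcT.
have [x0|noT] := pselect (exists x : T, True); last first.
  exists (fun=> set0); split=> [_|_ ? []|x]; first exact: compact0.
  by case: noT; exists x.
case: x0 => x0 _.
have [] := parT [set u | open u /\ exists2 K, compact K & u `<=` K].
- by move=> u [].
- move=> x; have [K cK nK] := lcT x.
  exists (K^°); last exact: nK.
  by split; [exact: open_interior|exists K => //; exact: interior_subset].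
move=> V [oV covV refV lfV].
have /choice [C HC] : forall v, exists K, V v -> compact K /\ v `<=` K.
  move=> v; have [Vv|nVv] := pselect (V v); last by exists set0.
  have [u [_ [K cK uK]] vu] := refV _ Vv.
  by exists K => _; split=> //; exact: subset_trans uK.
have fin K : compact K -> finite_set [set v | V v /\ v `&` K !=set0].
  move=> cK.
  apply: (compact_local_ind (P := fun A => finite_set [set v | V v /\ v `&` A !=set0]) cK).
  - apply: (@sub_finite_set _ _ set0) => // v [_ [y [_ []]]].
  - move=> A B AB; apply: sub_finite_set => v [Vv [y [vy Ay]]].
    by split=> //; exists y; split=> //; exact: AB.
  - move=> A B fA fB.
    apply: (@sub_finite_set _ _ ([set v | V v /\ v `&` A !=set0] `|`
                                 [set v | V v /\ v `&` B !=set0])).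
      by move=> v [Vv [y [vy [Ay|By]]]]; [left|right]; split=> //; exists y.
    by rewrite finite_setU.
  - by move=> x _; have [W nW fW] := lfV x; exists W.
pose next K := \bigcup_(v in [set v | V v /\ v `&` K !=set0]) C v.
pose K n := iter n next [set x0].
have cK n : compact (K n).
  elim: n => [|n IH]; first exact: compact_set1.
  apply: finite_bigcup_compact; first exact: fin.
  by move=> v [Vv _]; case: (HC v Vv).
have nextP n v y : V v -> v `&` K n !=set0 -> v y -> K n.+1 y.
  by move=> Vv vK vy; exists v => //; case: (HC v Vv) => _; apply.
have KS n : K n `<=` (K n.+1)^°.
  move=> y Ky; have [v Vv vy] := covV y.
  apply: (@filterS _ (nbhs y) _ v); last by apply: open_nbhs_nbhs; split=> //; exact: oV.
  by move=> z vz; apply: (nextP n v) => //; exists y.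
exists K; split=> // x.
suff E : \bigcup_n K n = [set: T].
  have : [set: T] x by [].
  by rewrite -E => -[n _ Kx]; exists n.
apply: conT.
- by exists x0; exists 0%N.
- exists (\bigcup_n K n); last by rewrite setTI.
  rewrite openE => y [n _ Ky]; apply: filterS (KS n y Ky) => z Kz.
  by exists n.+1.
- exists (\bigcup_n K n); last by rewrite setTI.
  move=> y cly; have [v Vv vy] := covV y.
  have [z [[n _ Kz] vz]] := cly v (open_nbhs_nbhs (conj (oV v Vv) vy)).
  by exists n.+1 => //; apply: (nextP n v) => //; exists z.
Qed.

Lemma exhaustible_paracompact T :
  hausdorff_space T -> exhaustible T -> paracompact T.
Proof.
move=> hT [K [cK KS covK]] U oU covU.
have clK n : closed (K n) by exact: compact_closed.
have Kle m n : (m <= n)%N -> K m `<=` K n.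
  elim: n => [|n IH]; first by rewrite leqn0 => /eqP ->.
  rewrite leq_eqVlt => /orP [/eqP -> //|/IH mn].
  by apply: (subset_trans mn); apply: (subset_trans (KS n)); exact: interior_subset.
pose P n := if n is n'.+1 then K n' else set0.
have clP n : closed (P n) by case: n => [|n] /=; [exact: closed0|exact: clK].
pose O n := (K n.+1)^° `\` P n.
have oO n : open (O n).
  by apply: openI; [exact: open_interior|exact: closed_openC].
have /choice [W HW] : forall n, exists W : set (set T),
    [/\ finite_set W, W `<=` U & K n `<=` \bigcup_(w in W) w].
  move=> n; apply: (compact_local_ind (P := fun A => exists W : set (set T),
    [/\ finite_set W, W `<=` U & A `<=` \bigcup_(w in W) w]) (cK n)).
  - by exists set0; split.
  - by move=> A B AB [W [? ? BW]]; exists W; split=> //; exact: subset_trans BW.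
  - move=> A B [W [fW WU AW]] [W' [fW' WU' AW']]; exists (W `|` W'); split.
    + by rewrite finite_setU.
    + by move=> w [/WU|/WU'].
    + by move=> y [/AW|/AW'] [w Ww wy]; exists w => //; [left|right].
  - move=> x _; have [u Uu ux] := covU x; exists u.
      by apply: open_nbhs_nbhs; split=> //; exact: oU.
    exists [set u]; split; first exact: finite_set1.
      by move=> w ->.
    by move=> y uy; exists u.
exists (\bigcup_n [set u `&` O n | u in W n]); split.
- move=> v [n _ [u Wu <-]]; apply: openI; last exact: oO.
  by apply: oU; case: (HW n) => _ + _; apply.
- move=> x; have [n0 Kn0] := covK x.
  have exn : exists n, `[< K n x >] by exists n0; apply/asboolP.
  case: (ex_minnP exn) => n /asboolP Kn minn.
  have [_ _ cov] := HW n; have [w Ww wx] := cov x Kn.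
  exists (w `&` O n); first by exists n => //; exists w.
  split=> //; split; first exact: KS.
  case: n {Ww cov Kn} minn => [|n] minn //= Kx.
  by have := minn n; rewrite ltnn => H; have := H (asboolT Kx).
- move=> v [n _ [u Wu <-]]; exists u; last exact: subIsetl.
  by case: (HW n) => _ + _; apply.
- move=> x; have [n Kn] := covK x.
  exists (K n.+1)^°; first by apply: open_nbhs_nbhs; split; [exact: open_interior|exact: KS].
  apply: (@sub_finite_set _ _ (\bigcup_(m in `I_n.+2) [set u `&` O m | u in W m])).
    move=> v [[m _ [u Wu uv]] [y [vy Ky]]]; exists m; last by exists u.
    rewrite /=; apply: contrapT => /negP; rewrite -leqNgt => nm.
    move: vy; rewrite -uv => -[_ [_]]; case: m nm {Wu uv} => // m nm; apply.
    by apply: (Kle n.+1) => //; exact: interior_subset.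
  apply: bigcup_finite; first exact: finite_II.
  by move=> m _; apply: finite_image; case: (HW m).
Qed.

Lemma exhaustible_prod S T :
  exhaustible S -> exhaustible T -> exhaustible (S * T)%type.
Proof.
move=> [K [cK KS covK]] [L [cL LS covL]].
have mono (X : topologicalType) (A : nat -> set X) :
    (forall n, A n `<=` (A n.+1)^°) -> forall m n, (m <= n)%N -> A m `<=` A n.
  move=> AS m n; elim: n => [|n IH]; first by rewrite leqn0 => /eqP ->.
  rewrite leq_eqVlt => /orP [/eqP -> //|/IH mn].
  by apply: (subset_trans mn); apply: (subset_trans (AS n)); exact: interior_subset.
exists (fun n => K n `*` L n); split.
- by move=> n; exact: compact_setX.
- move=> n [x y] [Kx Ly]; exists (K n.+1, L n.+1) => //.
  by split; [exact: KS|exact: LS].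
- move=> [x y]; have [m Km] := covK x; have [n Ln] := covL y.
  exists (maxn m n); split.
    exact: (mono _ _ KS m _ (leq_maxl m n)).
  exact: (mono _ _ LS n _ (leq_maxr m n)).
Qed.

Lemma hausdorff_prod S T :
  hausdorff_space S -> hausdorff_space T -> hausdorff_space (S * T)%type.
Proof.
move=> hS hT [x y] [x' y'] cl; congr pair.
- apply: hS => A B nA nB.
  have [] := cl (A `*` setT) (B `*` setT).
  + by exists (A, setT) => //; split=> //; exact: filterT.
  + by exists (B, setT) => //; split=> //; exact: filterT.
  + by move=> [a b] [[Aa _] [Ba _]]; exists a.
- apply: hT => A B nA nB.
  have [] := cl (setT `*` A) (setT `*` B).
  + by exists (setT, A) => //; split=> //; exact: filterT.
  + by exists (setT, B) => //; split=> //; exact: filterT.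
  + by move=> [a b] [[_ Aa] [_ Ba]]; exists b.
Qed.

Lemma connected_prod S T :
  connected [set: S] -> connected [set: T] -> connected [set: S * T].
Proof.
move=> cS cT B [[x0 y0] B0] [C oC BC] [D clD BD].
move: BC BD; rewrite !setTI => EC ED; subst C; subst D.
have c1 (x : S) : continuous (fun y : T => (x, y)).
  move=> y A [[P Q] /= [nP nQ] PQ]; apply: (@filterS _ (nbhs y) _ Q) nQ => z Qz.
  by apply: PQ; split=> //=; exact: (nbhs_singleton nP).
have c2 (y : T) : continuous (fun x : S => (x, y)).
  move=> x A [[P Q] /= [nP nQ] PQ]; apply: (@filterS _ (nbhs x) _ P) nP => z Pz.
  by apply: PQ; split=> //=; exact: (nbhs_singleton nQ).
have H1 : (fun y => (x0, y)) @^-1` B = setT.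
  apply: cT; first by exists y0.
    by eexists; last (by rewrite setTI); apply: open_comp => // *; exact: c1.
  by eexists; last (by rewrite setTI); apply: closed_comp => // *; exact: c1.
have H2 y : (fun x => (x, y)) @^-1` B = setT.
  apply: cS; first by exists x0; suff : ((fun y => (x0, y)) @^-1` B) y by []; rewrite H1.
    by eexists; last (by rewrite setTI); apply: open_comp => // *; exact: c2.
  by eexists; last (by rewrite setTI); apply: closed_comp => // *; exact: c2.
apply/seteqP; split=> // -[x y] _.
by suff : ((fun x => (x, y)) @^-1` B) x by []; rewrite H2.
Qed.

End Topology.

Section Calculus.
Implicit Types (R : realType) (m : nat).

Definition partial R m (i : 'I_m) (f : 'rV[R]_m -> R) : 'rV[R]_m -> R :=
  fun x => 'D_(delta_mx 0 i) f x.

(* [Ck k V f]: on the open set [V] all iterated partial derivatives of [f] of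
   order at most [k] exist and are continuous. *)
Fixpoint Ck R m (k : nat) (V : set 'rV[R]_m) (f : 'rV[R]_m -> R) : Prop :=
  (forall x, V x -> {for x, continuous f}) /\
  if k is k'.+1 then
    forall i : 'I_m, (forall x, V x -> derivable f x (delta_mx 0 i)) /\
                     Ck k' V (partial i f)
  else True.

Definition smooth_on R m (V : set 'rV[R]_m) (f : 'rV[R]_m -> R) : Prop :=
  forall k, Ck k V f.

Lemma Ck_cts R m k (V : set 'rV[R]_m) f :
  Ck k V f -> forall x, V x -> {for x, continuous f}.
Proof. by case: k => [|k] []. Qed.

Lemma Ck_pred R m k (V : set 'rV[R]_m) f : Ck k.+1 V f -> Ck k V f.
Proof.
elim: k f => [|k IH] f [cf H]; split=> // i.
by have [df Hf] := H i; split=> //; exact: IH.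
Qed.

Lemma partial_cst R m (i : 'I_m) (c : R) : partial i (fun=> c) = fun=> 0.
Proof. by apply/funext => x; rewrite /partial derive_cst. Qed.

Lemma Ck_cst R m k (V : set 'rV[R]_m) (c : R) : Ck k V (fun=> c).
Proof.
elim: k c => [|k IH] c; split; try by move=> x _; exact: cst_continuous.
  by [].
move=> i.
by split=> [x _|]; [exact: derivable_cst|rewrite partial_cst; exact: IH].
Qed.

Lemma Ck_ext R m k (V : set 'rV[R]_m) f g :
  open V -> (forall x, V x -> f x = g x) -> Ck k V f -> Ck k V g.
Proof.
move=> oV; have near_fg (f' g' : 'rV[R]_m -> R) :
    (forall x, V x -> f' x = g' x) -> forall x, V x -> \near x, f' x = g' x.
  move=> fg x Vx; apply: (@filterS _ (nbhs x) _ V) => //.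
  exact: open_nbhs_nbhs.
have cont (f' g' : 'rV[R]_m -> R) : (forall x, V x -> f' x = g' x) ->
    (forall x, V x -> {for x, continuous f'}) ->
    forall x, V x -> {for x, continuous g'}.
  move=> fg cf x Vx; have nfg := near_fg _ _ fg x Vx.
  have h := cf x Vx; rewrite /prop_for /continuous_at -(fg x Vx).
  exact: cvg_trans (near_eq_cvg nfg) h.
elim: k f g => [|k IH] f g fg [cf H].
  by split=> //; apply: cont fg cf.
split; first exact: cont fg cf.
move=> i; have [df Hf] := H i; split.
  by move=> x Vx; apply: near_eq_derivable (df x Vx); exact: near_fg.
apply: IH Hf => x Vx; rewrite /partial; apply: near_eq_derive.
exact: near_fg.
Qed.

Lemma Ck_add R m k (V : set 'rV[R]_m) f g : open V ->
  Ck k V f -> Ck k V g -> Ck k V (fun x => f x + g x).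
Proof.
move=> oV; elim: k f g => [|k IH] f g [cf Hf] [cg Hg]; split.
- by move=> x Vx; exact: (continuousD (cf x Vx) (cg x Vx)).
- by [].
- by move=> x Vx; exact: (continuousD (cf x Vx) (cg x Vx)).
- move=> i; have [df Hf'] := Hf i; have [dg Hg'] := Hg i; split.
    by move=> x Vx; apply: derivableD; [exact: df|exact: dg].
  apply: Ck_ext (IH _ _ Hf' Hg') => // x Vx.
  by rewrite /partial deriveD //; [exact: df|exact: dg].
Qed.

Lemma Ck_mul R m k (V : set 'rV[R]_m) f g : open V ->
  Ck k V f -> Ck k V g -> Ck k V (fun x => f x * g x).
Proof.
move=> oV; elim: k f g => [|k IH] f g Hf Hg; split.
- by move=> x Vx; exact: (continuousM (Ck_cts Hf Vx) (Ck_cts Hg Vx)).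
- by [].
- by move=> x Vx; exact: (continuousM (Ck_cts Hf Vx) (Ck_cts Hg Vx)).
- move=> i; have [_ /(_ i) [df Hf']] := Hf; have [_ /(_ i) [dg Hg']] := Hg.
  split; first by move=> x Vx; apply: derivableM; [exact: df|exact: dg].
  apply: Ck_ext (Ck_add oV (IH _ _ (Ck_pred Hf) Hg') (IH _ _ (Ck_pred Hg) Hf')) => // x Vx.
  by rewrite /partial deriveM //; [exact: df|exact: dg].
Qed.

Lemma eq_derive_line R (V V' : normedModType R) (f : V -> R) (g : V' -> R)
    (x v : V) (y w : V') :
  (forall h : R, f (h *: v + x) = g (h *: w + y)) ->
  'D_v f x = 'D_w g y /\ derivable f x v = derivable g y w.
Proof.
move=> fg; have fgx : f x = g y by have := fg 0; rewrite !scale0r !add0r.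
rewrite /derive /derivable.
have -> : (fun h => h^-1 *: ((f \o shift x) (h *: v) - f x)) =
          (fun h => h^-1 *: ((g \o shift y) (h *: w) - g y)).
  by apply/funext => h; rewrite /= fg fgx.
by [].
Qed.

Lemma line_lsubmx R m1 m2 (i : 'I_m1) (x : 'rV[R]_(m1 + m2)) (h : R) :
  lsubmx (h *: delta_mx 0 (lshift m2 i) + x) = h *: delta_mx 0 i + lsubmx x.
Proof. by rewrite delta_mx_lshift linearD linearZ /= row_mxKl. Qed.

Lemma line_lsubmx0 R m1 m2 (i : 'I_m2) (x : 'rV[R]_(m1 + m2)) (h : R) :
  lsubmx (h *: delta_mx 0 (rshift m1 i) + x) = h *: 0 + lsubmx x.
Proof. by rewrite delta_mx_rshift linearD linearZ /= row_mxKl. Qed.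

Lemma partial_lsubmx R m1 m2 (i : 'I_m1) (f : 'rV[R]_m1 -> R) :
  partial (lshift m2 i) (fun x => f (lsubmx x)) = fun x => partial i f (lsubmx x).
Proof.
apply/funext => x; rewrite /partial.
by rewrite (eq_derive_line (fun h => congr1 f (line_lsubmx i x h))).1.
Qed.

Lemma derivable_lsubmx R m1 m2 (i : 'I_m1) (f : 'rV[R]_m1 -> R)
    (x : 'rV[R]_(m1 + m2)) :
  derivable f (lsubmx x) (delta_mx 0 i) ->
  derivable (fun x => f (lsubmx x)) x (delta_mx 0 (lshift m2 i)).
Proof. by rewrite (eq_derive_line (fun h => congr1 f (line_lsubmx i x h))).2. Qed.

Lemma partial_lsubmx0 R m1 m2 (i : 'I_m2) (f : 'rV[R]_m1 -> R) :
  partial (rshift m1 i) (fun x => f (lsubmx x)) = fun=> 0.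
Proof.
apply/funext => x; rewrite /partial.
by rewrite (eq_derive_line (fun h => congr1 f (line_lsubmx0 i x h))).1 derive0.
Qed.

Lemma derivable_lsubmx0 R m1 m2 (i : 'I_m2) (f : 'rV[R]_m1 -> R)
    (x : 'rV[R]_(m1 + m2)) :
  derivable (fun x => f (lsubmx x)) x (delta_mx 0 (rshift m1 i)).
Proof.
rewrite (eq_derive_line (fun h => congr1 f (line_lsubmx0 i x h))).2.
exact: derivable0.
Qed.

Lemma Ck_lsubmx R m1 m2 k (V : set 'rV[R]_m1) (W : set 'rV[R]_(m1 + m2)) f :
  (forall x, W x -> V (lsubmx x)) -> Ck k V f -> Ck k W (fun x => f (lsubmx x)).
Proof.
move=> WV; elim: k f => [|k IH] f [cf H].
  split=> // x Wx; apply: continuous_comp; first exact: continuous_lsubmx.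
  exact: cf (WV _ Wx).
split.
  move=> x Wx; apply: continuous_comp; first exact: continuous_lsubmx.
  exact: cf (WV _ Wx).
move=> i; case: (split_ordP i) => j ->.
  have [df Hf] := H j; split.
    by move=> x Wx; apply: derivable_lsubmx; exact: df (WV _ Wx).
  by rewrite partial_lsubmx; exact: IH.
split; first by move=> x _; exact: derivable_lsubmx0.
by rewrite partial_lsubmx0; exact: Ck_cst.
Qed.

Lemma line_rsubmx R m1 m2 (i : 'I_m2) (x : 'rV[R]_(m1 + m2)) (h : R) :
  rsubmx (h *: delta_mx 0 (rshift m1 i) + x) = h *: delta_mx 0 i + rsubmx x.
Proof. by rewrite delta_mx_rshift linearD linearZ /= row_mxKr. Qed.

Lemma line_rsubmx0 R m1 m2 (i : 'I_m1) (x : 'rV[R]_(m1 + m2)) (h : R) :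
  rsubmx (h *: delta_mx 0 (lshift m2 i) + x) = h *: 0 + rsubmx x.
Proof. by rewrite delta_mx_lshift linearD linearZ /= row_mxKr. Qed.

Lemma partial_rsubmx R m1 m2 (i : 'I_m2) (f : 'rV[R]_m2 -> R) :
  partial (rshift m1 i) (fun x => f (rsubmx x)) = fun x => partial i f (rsubmx x).
Proof.
apply/funext => x; rewrite /partial.
by rewrite (eq_derive_line (fun h => congr1 f (line_rsubmx i x h))).1.
Qed.

Lemma derivable_rsubmx R m1 m2 (i : 'I_m2) (f : 'rV[R]_m2 -> R)
    (x : 'rV[R]_(m1 + m2)) :
  derivable f (rsubmx x) (delta_mx 0 i) ->
  derivable (fun x => f (rsubmx x)) x (delta_mx 0 (rshift m1 i)).
Proof. by rewrite (eq_derive_line (fun h => congr1 f (line_rsubmx i x h))).2. Qed.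

Lemma partial_rsubmx0 R m1 m2 (i : 'I_m1) (f : 'rV[R]_m2 -> R) :
  partial (lshift m2 i) (fun x => f (rsubmx x)) = fun=> 0.
Proof.
apply/funext => x; rewrite /partial.
by rewrite (eq_derive_line (fun h => congr1 f (line_rsubmx0 i x h))).1 derive0.
Qed.

Lemma derivable_rsubmx0 R m1 m2 (i : 'I_m1) (f : 'rV[R]_m2 -> R)
    (x : 'rV[R]_(m1 + m2)) :
  derivable (fun x => f (rsubmx x)) x (delta_mx 0 (lshift m2 i)).
Proof.
rewrite (eq_derive_line (fun h => congr1 f (line_rsubmx0 i x h))).2.
exact: derivable0.
Qed.

Lemma Ck_rsubmx R m1 m2 k (V : set 'rV[R]_m2) (W : set 'rV[R]_(m1 + m2)) f :
  (forall x, W x -> V (rsubmx x)) -> Ck k V f -> Ck k W (fun x => f (rsubmx x)).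
Proof.
move=> WV; elim: k f => [|k IH] f [cf H].
  split=> // x Wx; apply: continuous_comp; first exact: continuous_rsubmx.
  exact: cf (WV _ Wx).
split.
  move=> x Wx; apply: continuous_comp; first exact: continuous_rsubmx.
  exact: cf (WV _ Wx).
move=> i; case: (split_ordP i) => j ->.
  split; first by move=> x _; exact: derivable_rsubmx0.
  by rewrite partial_rsubmx0; exact: Ck_cst.
have [df Hf] := H j; split.
  by move=> x Wx; apply: derivable_rsubmx; exact: df (WV _ Wx).
by rewrite partial_rsubmx; exact: IH.
Qed.

End Calculus.

(* [cmap] and [cinv] are total functions, meaningful only on [cdom] and [cimg];
   since these sets are open, continuity there is continuity at their points. *)
Record chart (R : realType) (T : topologicalType) (m : nat) := Chart {
  cdom : set T;
  cimg : set 'rV[R]_m;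
  cmap : T -> 'rV[R]_m;
  cinv : 'rV[R]_m -> T;
  cdom_open : open cdom;
  cimg_open : open cimg;
  cmap_cimg : forall p, cdom p -> cimg (cmap p);
  cinv_cdom : forall x, cimg x -> cdom (cinv x);
  cmapK : forall p, cdom p -> cinv (cmap p) = p;
  cinvK : forall x, cimg x -> cmap (cinv x) = x;
  cmap_continuous : forall p, cdom p -> {for p, continuous cmap};
  cinv_continuous : forall x, cimg x -> {for x, continuous cinv} }.

Definition overlap R T m (c d : chart R T m) : set 'rV[R]_m :=
  [set x | cimg c x /\ cdom d (cinv c x)].

Definition transition R T m (c d : chart R T m) (x : 'rV[R]_m) : 'rV[R]_m :=
  cmap d (cinv c x).

(* The C^oo structure is given by an indexed, not necessarily maximal, atlas.
   [chart_at p] selects a chart around [p]; its coordinate frame identifies the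
   tangent space at [p] with R^m, so that a tensor at [p] has a matrix. *)
Record manifold (R : realType) (m : nat) := Manifold {
  carrier :> topologicalType;
  atlas_index : Type;
  atlas : atlas_index -> chart R carrier m;
  chart_at : carrier -> atlas_index;
  chart_atP : forall p, cdom (atlas (chart_at p)) p;
  transition_smooth : forall i j (k : 'I_m),
    smooth_on (overlap (atlas i) (atlas j))
      (fun x => transition (atlas i) (atlas j) x 0 k);
  manifold_hausdorff : hausdorff_space carrier;
  manifold_connected : connected [set: carrier];
  manifold_paracompact : paracompact carrier }.

Definition jacobian_mx (R : realType) m (f : 'rV[R]_m -> 'rV[R]_m) (x : 'rV[R]_m) : 'M[R]_m :=
  \matrix_(a, b) partial a (fun y => f y 0 b) x.

(* The components of the metric in each chart. Row-vector convention:
   g(v, w) = v *m G *m w^T and dt(v) = v *m jacobian_mx t x. The index of the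
   metric is constant because the manifold is connected. *)
Record sr_metric R m (M : manifold R m) := SrMetric {
  metric_in : atlas_index M -> 'rV[R]_m -> 'M[R]_m;
  metric_smooth : forall i a b,
    smooth_on (cimg (atlas i)) (fun x => metric_in i x a b);
  metric_sym : forall i x, cimg (atlas i) x ->
    (metric_in i x)^T = metric_in i x;
  metric_nondeg : forall i x, cimg (atlas i) x -> metric_in i x \in unitmx;
  metric_compat : forall i j x, overlap (atlas i) (atlas j) x ->
    let t := transition (atlas i) (atlas j) in
    metric_in i x =
      jacobian_mx t x *m metric_in j (t x) *m (jacobian_mx t x)^T }.

Record sr_manifold (R : realType) (m : nat) := SrManifold {
  sr_carrier :> manifold R m;
  metric_of :> sr_metric sr_carrier }.

Definition smooth_fun R m (M : manifold R m) (F : M -> R) : Prop :=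
  forall i, smooth_on (cimg (atlas i)) (fun x => F (@cinv _ _ _ (atlas i) x)).

(* Geometry of an open set of R^m with metric components [G] in the standard
   coordinates. *)
Section Curvature.
Variables (R : realType) (m : nat) (G : 'rV[R]_m -> 'M[R]_m).
Implicit Types (X Y Z : 'rV[R]_m -> 'rV[R]_m) (x : 'rV[R]_m).

Definition christoffel (k i j : 'I_m) x : R :=
  2^-1 * \sum_l invmx (G x) k l *
    (partial i (fun y => G y j l) x + partial j (fun y => G y i l) x
     - partial l (fun y => G y i j) x).

Definition nabla X Y : 'rV[R]_m -> 'rV[R]_m := fun x =>
  \row_k \sum_i X x 0 i * (partial i (fun y => Y y 0 k) x
                           + \sum_j christoffel k i j x * Y x 0 j).

Definition lie_bracket X Y : 'rV[R]_m -> 'rV[R]_m := fun x =>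
  \row_k \sum_i (X x 0 i * partial i (fun y => Y y 0 k) x
                 - Y x 0 i * partial i (fun y => X y 0 k) x).

Definition curvature X Y Z : 'rV[R]_m -> 'rV[R]_m := fun x =>
  nabla X (nabla Y Z) x - nabla Y (nabla X Z) x - nabla (lie_bracket X Y) Z x.

Definition frame (i : 'I_m) : 'rV[R]_m -> 'rV[R]_m := fun=> delta_mx 0 i.

(* S(X, Y) = tr {Z |-> R(Z, X) Y}, on the coordinate fields. *)
Definition ricci_local x : 'M[R]_m := \matrix_(i, j)
  \tr (\matrix_(k, l) curvature (frame k) (frame i) (frame j) x 0 l).

Definition metric_trace x (A : 'M[R]_m) : R := \sum_i \sum_j invmx (G x) i j * A i j.

Definition hessian (f : 'rV[R]_m -> R) x : 'M[R]_m := \matrix_(a, b)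
  (partial a (partial b f) x - \sum_c christoffel c a b x * partial c f x).

(* T_ab = nabla_a F_b - (1 / 2F) F_a F_b *)
Definition warping_T (f : 'rV[R]_m -> R) x : 'M[R]_m := \matrix_(a, b)
  (hessian f x a b - (2 * f x)^-1 * partial a f x * partial b f x).

Definition gradient_sq (f : 'rV[R]_m -> R) x : R :=
  metric_trace x (\matrix_(a, b) (partial a f x * partial b f x)).

End Curvature.

(* Tensors at [p] by their matrices in the coordinate frame of [chart_at p];
   equality, rank and metric traces do not depend on the frame. *)
Section PointwiseTensors.
Variables (R : realType) (m : nat) (M : sr_manifold R m).
Implicit Types (p : M) (F : M -> R).

Definition chart_pt p : 'rV[R]_m := cmap (atlas (chart_at p)) p.
Definition metric_at p : 'M[R]_m := metric_in M (chart_at p) (chart_pt p).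
Definition ricci p : 'M[R]_m :=
  ricci_local (metric_in M (chart_at p)) (chart_pt p).
Definition scalar_curvature p : R :=
  metric_trace (metric_in M (chart_at p)) (chart_pt p) (ricci p).

Definition in_chart_at p F (x : 'rV[R]_m) : R := F (cinv (atlas (chart_at p)) x).
Definition trT F p : R :=
  metric_trace (metric_in M (chart_at p)) (chart_pt p)
    (warping_T (metric_in M (chart_at p)) (in_chart_at p F) (chart_pt p)).
Definition Delta1 F p : R :=
  gradient_sq (metric_in M (chart_at p)) (in_chart_at p F) (chart_pt p).

Definition einstein_at p : Prop :=
  ricci p = (scalar_curvature p / m%:R) *: metric_at p.
Definition einstein : Prop := forall p, einstein_at p.
Definition U_S : set M := [set p | ~ einstein_at p].

Definition two_quasi_einstein : Prop :=
  (3 <= m)%N /\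
  exists alpha : M -> R,
    (forall p, U_S p -> (\rank (ricci p - alpha p *: metric_at p)%R <= 2)%N) /\
    exists W : set M, [/\ open W, W !=set0, W `<=` U_S &
      forall p, W p -> \rank (ricci p - alpha p *: metric_at p) = 2%N].

End PointwiseTensors.

Arguments U_S {R m} M _.

Lemma manifold_locally_cpt R m (M : manifold R m) : locally_cpt M.
Proof.
move=> p; pose c := atlas (chart_at p); have cp : cdom c p := chart_atP p.
have /nbhs_closedballP [r rV] : nbhs (cmap c p) (cimg c).
  by apply: open_nbhs_nbhs; split; [exact: cimg_open|exact: cmap_cimg].
exists (cinv c @` closed_ball (cmap c p) r%:num).
  apply: continuous_compact.
    apply: continuous_in_subspaceT => x /set_mem xB.
    exact: cinv_continuous (rV _ xB).
  apply: bounded_closed_compact; last exact: closed_ball_closed.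
  exists (`|cmap c p| + r%:num); split; first exact: num_real.
  move=> e re x /=; rewrite closed_ballE // /closed_ball_ /= => xB.
  rewrite (le_trans _ (ltW re)) // -[x](subrK (cmap c p)) addrC.
  by rewrite (le_trans (ler_normD _ _)) // lerD2l distrC.
have nB : nbhs p (cmap c @^-1` closed_ball (cmap c p) r%:num).
  apply: (cmap_continuous cp); apply/nbhs_closedballP; by exists r.
have nD : nbhs p (cdom c) by apply: open_nbhs_nbhs; split=> //; exact: cdom_open.
apply: filterS (filterI nB nD) => q [Bq cq].
by exists (cmap c q) => //; exact: cmapK.
Qed.

Lemma continuous_row_mx (R : realType) (T : topologicalType) m1 m2
    (f : T -> 'rV[R]_m1) (g : T -> 'rV[R]_m2) (p : T) :
  {for p, continuous f} -> {for p, continuous g} ->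
  {for p, continuous (fun q => row_mx (f q) (g q))}.
Proof.
move=> cf cg A [P nP PA].
have nf : nbhs p [set q | forall j, P 0 (lshift m2 j) (f q 0 j)].
  apply: (cf [set y | forall j, P 0 (lshift m2 j) (y 0 j)]).
  exists (fun i j => P i (lshift m2 j)); last by move=> y Py j; exact: Py.
  by move=> i j; have := nP i (lshift m2 j); rewrite (ord1 i) row_mxEl.
have ng : nbhs p [set q | forall j, P 0 (rshift m1 j) (g q 0 j)].
  apply: (cg [set y | forall j, P 0 (rshift m1 j) (y 0 j)]).
  exists (fun i j => P i (rshift m1 j)); last by move=> y Py j; exact: Py.
  by move=> i j; have := nP i (rshift m1 j); rewrite (ord1 i) row_mxEr.
apply: (@filterS _ (nbhs p) _ _ _ _ (filterI nf ng)) => q [/= fq gq].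
apply: PA => i j; rewrite (ord1 i); case: (split_ordP j) => k ->.
  by rewrite row_mxEl.
by rewrite row_mxEr.
Qed.

Section ProductChart.
Variables (R : realType) (S T : topologicalType) (m1 m2 : nat).
Variables (c : chart R S m1) (d : chart R T m2).

Let pdom : set (S * T) := cdom c `*` cdom d.
Let pimg : set 'rV[R]_(m1 + m2) :=
  [set x | cimg c (lsubmx x) /\ cimg d (rsubmx x)].
Let pmap (z : S * T) : 'rV[R]_(m1 + m2) := row_mx (cmap c z.1) (cmap d z.2).
Let pinv (x : 'rV[R]_(m1 + m2)) : S * T := (cinv c (lsubmx x), cinv d (rsubmx x)).

Let pdom_open : open pdom.
Proof.
rewrite openE => -[p q] [/= cp dq]; exists (cdom c, cdom d) => //.
by split; apply: open_nbhs_nbhs; split=> //; exact: cdom_open.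
Qed.

Let pimg_open : open pimg.
Proof.
apply: openI.
  by apply: open_comp; [move=> x _; exact: continuous_lsubmx|exact: cimg_open].
by apply: open_comp; [move=> x _; exact: continuous_rsubmx|exact: cimg_open].
Qed.

Let pmap_pimg z : pdom z -> pimg (pmap z).
Proof.
by case=> cz dz; rewrite /pimg /pmap /= row_mxKl row_mxKr; split; exact: cmap_cimg.
Qed.

Let pinv_pdom x : pimg x -> pdom (pinv x).
Proof. by case=> cx dx; split; exact: cinv_cdom. Qed.

Let pmapK z : pdom z -> pinv (pmap z) = z.
Proof.
case: z => p q [/= cz dz]; rewrite /pinv /pmap row_mxKl row_mxKr /=.
by rewrite !cmapK.
Qed.

Let pinvK x : pimg x -> pmap (pinv x) = x.
Proof. by case=> cx dx; rewrite /pmap /= !cinvK // hsubmxK. Qed.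

Let pmap_continuous z : pdom z -> {for z, continuous pmap}.
Proof.
case: z => p q [/= cz dz]; apply: continuous_row_mx.
  by apply: continuous_comp; [exact: cvg_fst|exact: cmap_continuous].
by apply: continuous_comp; [exact: cvg_snd|exact: cmap_continuous].
Qed.

Let pinv_continuous x : pimg x -> {for x, continuous pinv}.
Proof.
case=> cx dx A [[P Q] /= [nP nQ] PQ].
have nl : nbhs x [set y | P (cinv c (lsubmx y))].
  exact: continuous_lsubmx (cinv_continuous cx nP).
have nr : nbhs x [set y | Q (cinv d (rsubmx y))].
  exact: continuous_rsubmx (cinv_continuous dx nQ).
by apply: filterS (filterI nl nr) => y [Py Qy]; exact: PQ.
Qed.

Definition prod_chart : chart R (S * T)%type (m1 + m2) :=
  Chart pdom_open pimg_open pmap_pimg pinv_pdom pmapK pinvK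
    pmap_continuous pinv_continuous.

End ProductChart.

Section Product.
Variables (R : realType) (m1 m2 : nat) (M : manifold R m1) (N : manifold R m2).

Let pindex : Type := (atlas_index M * atlas_index N)%type.
Let patlas (i : pindex) : chart R (M * N)%type (m1 + m2) :=
  prod_chart (atlas i.1) (atlas i.2).
Let pchart_at (z : M * N) : pindex := (chart_at z.1, chart_at z.2).

Let pchart_atP z : cdom (patlas (pchart_at z)) z.
Proof. by split; exact: chart_atP. Qed.

Lemma prod_transition (i j : pindex) :
  transition (patlas i) (patlas j) = fun x =>
    row_mx (transition (atlas i.1) (atlas j.1) (lsubmx x))
           (transition (atlas i.2) (atlas j.2) (rsubmx x)).
Proof. by []. Qed.

Let ptransition_smooth i j (k : 'I_(m1 + m2)) :
  smooth_on (overlap (patlas i) (patlas j))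
    (fun x => transition (patlas i) (patlas j) x 0 k).
Proof.
move=> r; rewrite prod_transition; case: (split_ordP k) => l ->.
  under [X in Ck _ _ X]eq_fun do rewrite row_mxEl.
  by apply: Ck_lsubmx (transition_smooth i.1 j.1 l r) => x [[? _] [? _]].
under [X in Ck _ _ X]eq_fun do rewrite row_mxEr.
by apply: Ck_rsubmx (transition_smooth i.2 j.2 l r) => x [[_ ?] [_ ?]].
Qed.

Let pparacompact : paracompact (M * N)%type.
Proof.
apply: exhaustible_paracompact.
  exact: hausdorff_prod (@manifold_hausdorff _ _ M) (@manifold_hausdorff _ _ N).
apply: exhaustible_prod; apply: paracompact_exhaustible;
  by [exact: manifold_connected|exact: manifold_paracompact
     |exact: manifold_locally_cpt].
Qed.

Definition prod_manifold : manifold R (m1 + m2) :=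
  Manifold pchart_atP ptransition_smooth
    (hausdorff_prod (@manifold_hausdorff _ _ M) (@manifold_hausdorff _ _ N))
    (connected_prod (@manifold_connected _ _ M) (@manifold_connected _ _ N))
    pparacompact.

End Product.

Lemma jacobian_prod (R : realType) m1 m2 (f : 'rV[R]_m1 -> 'rV[R]_m1)
    (g : 'rV[R]_m2 -> 'rV[R]_m2) (x : 'rV[R]_(m1 + m2)) :
  jacobian_mx (fun y => row_mx (f (lsubmx y)) (g (rsubmx y))) x =
  block_mx (jacobian_mx f (lsubmx x)) 0 0 (jacobian_mx g (rsubmx x)).
Proof.
apply/matrixP => a b; rewrite mxE.
case: (split_ordP b) => b' ->.
  under [X in partial _ X]eq_fun do rewrite row_mxEl.
  case: (split_ordP a) => a' ->; rewrite ?block_mxEul ?block_mxEdl mxE.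
    by rewrite (partial_lsubmx _ a' (fun y => f y 0 b')).
  by rewrite (partial_lsubmx0 a' (fun y => f y 0 b')).
under [X in partial _ X]eq_fun do rewrite row_mxEr.
case: (split_ordP a) => a' ->; rewrite ?block_mxEur ?block_mxEdr mxE.
  by rewrite (partial_rsubmx0 a' (fun y => g y 0 b')).
by rewrite (partial_rsubmx _ a' (fun y => g y 0 b')).
Qed.

(* pi_1^* g_M + (F \o pi_1) pi_2^* g_N in the product charts. *)
Section WarpedProduct.
Variables (R : realType) (m1 m2 : nat).
Variables (M : sr_manifold R m1) (N : sr_manifold R m2).
Variables (F : M -> R) (F_smooth : smooth_fun F) (F_gt0 : forall p, 0 < F p).

Let P := prod_manifold M N.

Let wmetric (i : atlas_index P) (x : 'rV[R]_(m1 + m2)) : 'M[R]_(m1 + m2) :=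
  block_mx (metric_in M i.1 (lsubmx x)) 0
           0 (F (cinv (atlas i.1) (lsubmx x)) *: metric_in N i.2 (rsubmx x)).

Let wmetric_smooth i a b :
  smooth_on (cimg (atlas i)) (fun x => wmetric i x a b).
Proof.
move=> k; rewrite /wmetric; case: (split_ordP a) => a' ->; case: (split_ordP b) => b' ->.
- under [X in Ck _ _ X]eq_fun do rewrite block_mxEul.
  by apply: Ck_lsubmx (metric_smooth M i.1 a' b' k) => x [].
- by under [X in Ck _ _ X]eq_fun do rewrite block_mxEur mxE; exact: Ck_cst.
- by under [X in Ck _ _ X]eq_fun do rewrite block_mxEdl mxE; exact: Ck_cst.
- under [X in Ck _ _ X]eq_fun do rewrite block_mxEdr mxE.
  apply: Ck_mul; first exact: cimg_open.
    by apply: Ck_lsubmx (F_smooth i.1 k) => x [].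
  by apply: Ck_rsubmx (metric_smooth N i.2 a' b' k) => x [].
Qed.

Let wmetric_sym i x : cimg (atlas i) x -> (wmetric i x)^T = wmetric i x.
Proof.
by case=> x1 x2; rewrite /wmetric tr_block_mx !trmx0 linearZ /= !metric_sym.
Qed.

Let wmetric_nondeg i x : cimg (atlas i) x -> wmetric i x \in unitmx.
Proof.
case=> x1 x2; rewrite /wmetric unitmxE det_ublock unitrM -!unitmxE.
by rewrite unitmxZ ?unitfE ?gt_eqF // !metric_nondeg.
Qed.

Let wmetric_compat i j x : overlap (atlas i) (atlas j) x ->
  let t := transition (@atlas _ _ P i) (atlas j) in
  wmetric i x = jacobian_mx t x *m wmetric j (t x) *m (jacobian_mx t x)^T.
Proof.
move=> [[x1 x2] [y1 y2]] /=.
rewrite prod_transition jacobian_prod /wmetric row_mxKl row_mxKr.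
rewrite tr_block_mx !trmx0 !mulmx_block.
rewrite !(mul0mx, mulmx0, addr0, add0r) -!scalemxAr -scalemxAl.
rewrite (metric_compat M (conj x1 y1)) (metric_compat N (conj x2 y2)) /=.
by rewrite {3}/transition cmapK.
Qed.

Definition warped_product : sr_manifold R (m1 + m2) :=
  SrManifold (SrMetric wmetric_smooth wmetric_sym wmetric_nondeg wmetric_compat).

End WarpedProduct.

Definition tau1 (R : realType) (n : nat) (M : sr_manifold R 2)
    (N : sr_manifold R (n - 2)) (F : M -> R) (z : M * N) : R :=
  scalar_curvature z.2 / ((n - 2)%:R * F z.1)
  - trT F z.1 / (2 * F z.1)
  - (n - 3)%:R * Delta1 F z.1 / (4 * F z.1 ^+ 2).

(* Main.v *)
(* In a product chart the Christoffel symbols of the warped metric are those of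
   the factors, Gamma^c_(alpha beta) = - (1/2) (grad F)^c g~_(alpha beta) and
   Gamma^gamma_(a beta) = (F_a / 2F) delta^gamma_beta; the others vanish. Hence
   S_(alpha b) = 0 and
   S_(alpha beta) = S~_(alpha beta)
     - (1/2) (tr T + (n - 3) Delta_1 F / (2F)) g~_(alpha beta).
   When S~ is proportional to g~, the function tau_1 is the one for which the
   fibre rows of S - tau_1 g vanish, so only the two base rows contribute to
   the rank. For n = 4 the fibre is a surface, where S~ = (kappa~/2) g~ because
   the curvature operator of a coordinate plane is skew-adjoint; this rests on
   the symmetry of second derivatives of the metric. *)
Require Import Defs.
From mathcomp Require Import all_boot all_order all_algebra.
From mathcomp Require Import boolp classical_sets.
From mathcomp Require Import reals topology normedtype.
From mathcomp Require Import derive ring lra.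

Set Implicit Arguments.
Unset Strict Implicit.
Unset Printing Implicit Defensive.

Import Order.TTheory GRing.Theory Num.Theory.
Import numFieldNormedType.Exports.

Local Open Scope classical_set_scope.
Local Open Scope ring_scope.

(** * Derivatives of sums, determinants and inverse matrices *)

Section Derivability.
Variables (R : realType) (V : normedModType R).
Implicit Types (x v : V).

Lemma derivable_bigsum (I : Type) (r : seq I) (P : pred I) (f : I -> V -> R) x v :
  (forall i, P i -> derivable (f i) x v) ->
  derivable (fun y => \sum_(i <- r | P i) f i y) x v.
Proof.
move=> df; elim: r => [|i r IH].
  under [X in derivable X]eq_fun do rewrite big_nil.
  exact: derivable_cst.
under [X in derivable X]eq_fun do rewrite big_cons.
case: ifP => Pi; last exact: IH.
by apply: derivableD IH; exact: df.
Qed.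

Lemma derivable_bigprod (I : Type) (r : seq I) (P : pred I) (f : I -> V -> R) x v :
  (forall i, P i -> derivable (f i) x v) ->
  derivable (fun y => \prod_(i <- r | P i) f i y) x v.
Proof.
move=> df; elim: r => [|i r IH].
  under [X in derivable X]eq_fun do rewrite big_nil.
  exact: derivable_cst.
under [X in derivable X]eq_fun do rewrite big_cons.
case: ifP => Pi; last exact: IH.
by apply: derivableM IH; exact: df.
Qed.

Lemma derivable_det n (A : V -> 'M[R]_n) x v :
  (forall i j, derivable (fun y => A y i j) x v) ->
  derivable (fun y => \det (A y)) x v.
Proof.
move=> dA; apply: derivable_bigsum => s _.
apply: derivableM; first exact: derivable_cst.
by apply: derivable_bigprod => i _; exact: dA.
Qed.

(** Near [x] the inverse is the adjugate divided by the determinant, and both are polynomial in the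
    entries of [A]. Invertibility is asked on a neighbourhood because [invmx] returns a singular
    matrix unchanged. *)
Lemma derivable_invmx n (A : V -> 'M[R]_n) x v :
  (\forall y \near x, A y \in unitmx) ->
  (forall i j, derivable (fun y => A y i j) x v) ->
  forall i j, derivable (fun y => invmx (A y) i j) x v.
Proof.
move=> uA dA i j.
apply: (@near_eq_derivable _ _ _ (fun y => (\det (A y))^-1 * \adj (A y) i j)).
  by apply: filterS uA => y uy; rewrite /invmx uy !mxE.
apply: derivableM.
  apply: derivableV; last exact: derivable_det.
  by rewrite -unitfE -unitmxE; exact: nbhs_singleton uA.
under [X in derivable X]eq_fun do rewrite mxE.
apply: derivableM; first exact: derivable_cst.
apply: derivable_det => k l.
by under [X in derivable X]eq_fun do rewrite !mxE; exact: dA.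
Qed.

Lemma derive_bigsum (I : Type) (r : seq I) (P : pred I) (f : I -> V -> R) x v :
  (forall i, P i -> derivable (f i) x v) ->
  'D_v (fun y => \sum_(i <- r | P i) f i y) x = \sum_(i <- r | P i) 'D_v (f i) x.
Proof.
move=> df; elim: r => [|i r IH].
  under [X in derive X]eq_fun do rewrite big_nil.
  by rewrite big_nil; exact: derive_cst.
under [X in derive X]eq_fun do rewrite big_cons.
rewrite big_cons; case: ifP => Pi; last exact: IH.
rewrite -IH; apply: deriveD; first exact: df.
exact: derivable_bigsum.
Qed.

End Derivability.

(** * Entrywise partial derivatives of matrix-valued functions *)

Section Partials.
Variables (R : realType) (m : nat).
Implicit Types (x : 'rV[R]_m) (f g : 'rV[R]_m -> R) (V : set 'rV[R]_m).

Lemma partial_ext (i : 'I_m) V f g x :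
  open V -> V x -> {in V, f =1 g} -> partial i f x = partial i g x.
Proof.
move=> oV Vx fg; apply: near_eq_derive.
apply: (@filterS _ (nbhs x) _ V); last by apply: open_nbhs_nbhs.
by move=> y Vy; apply: fg; rewrite inE.
Qed.

Lemma smooth_derivable (i : 'I_m) V f x :
  smooth_on V f -> V x -> derivable f x (delta_mx 0 i).
Proof. by move=> /(_ 1%N) [_ /(_ i) [df _]]; exact: df. Qed.

Lemma smooth_partial (i : 'I_m) V f : smooth_on V f -> smooth_on V (partial i f).
Proof. by move=> sf k; have [_ /(_ i) []] := sf k.+1. Qed.

Definition partial_mx p q (i : 'I_m) (A : 'rV[R]_m -> 'M[R]_(p, q)) x : 'M[R]_(p, q) :=
  \matrix_(a, b) partial i (fun y => A y a b) x.

Lemma partial_mxM p q r (i : 'I_m) (A : 'rV[R]_m -> 'M[R]_(p, q))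
    (B : 'rV[R]_m -> 'M[R]_(q, r)) x :
  (forall a b, derivable (fun y => A y a b) x (delta_mx 0 i)) ->
  (forall a b, derivable (fun y => B y a b) x (delta_mx 0 i)) ->
  partial_mx i (fun y => A y *m B y) x =
  partial_mx i A x *m B x + A x *m partial_mx i B x.
Proof.
move=> dA dB; apply/matrixP => a b; rewrite !mxE /partial.
under [X in derive X]eq_fun do rewrite mxE.
rewrite derive_bigsum => [|c _]; last by apply: derivableM; [exact: dA|exact: dB].
rewrite -big_split; apply: eq_bigr => c _ /=; rewrite !mxE.
rewrite deriveM; [|exact: dA|exact: dB].
by rewrite addrC; congr (_ + _); exact: mulrC.
Qed.

(** Differentiate A A^-1 = 1, which holds on all of [V], and multiply by A^-1 on the left. *)
Lemma partial_invmx (i : 'I_m) V n (A : 'rV[R]_m -> 'M[R]_n) x :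
  open V -> V x -> (forall y, V y -> A y \in unitmx) ->
  (forall a b, derivable (fun y => A y a b) x (delta_mx 0 i)) ->
  partial_mx i (fun y => invmx (A y)) x =
  - (invmx (A x) *m partial_mx i A x *m invmx (A x)).
Proof.
move=> oV Vx uA dA.
have nV : \forall y \near x, A y \in unitmx.
  by apply: (@filterS _ (nbhs x) _ V) => //; exact: open_nbhs_nbhs.
have : partial_mx i (fun y => A y *m invmx (A y)) x = 0.
  apply/matrixP => a b; rewrite !mxE.
  rewrite (@partial_ext _ V _ (fun=> 1%:M a b)) ?partial_cst //.
  by move=> y /[!inE] Vy; rewrite mulmxV ?uA.
rewrite partial_mxM; [|exact: dA|exact: derivable_invmx].
move=> /(congr1 (mulmx (invmx (A x)))).
rewrite mulmx0 mulmxDr !mulmxA mulVmx ?uA // mul1mx => /eqP.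
by rewrite addrC addr_eq0 => /eqP.
Qed.

End Partials.

(** * Symmetry of second derivatives *)

Lemma ler_dist_half (R : realFieldType) (a b c e : R) :
  `|a - c| < e / 2 -> `|b - c| < e / 2 -> `|a - b| <= e.
Proof.
move=> ac bc; rewrite (le_trans (ler_distD c _ _)) // [e]splitr ltW //.
by rewrite ltrD // distrC.
Qed.

Section Schwarz.
Variables (R : realType) (W : normedModType R).
Implicit Types (f : W -> R) (x y v w : W) (A : set W).

Lemma mean_value_line f y v (h : R) : 0 < h ->
  (forall s, 0 <= s <= h -> derivable f (s *: v + y) v) ->
  exists2 s, 0 <= s <= h & f (h *: v + y) - f y = 'D_v f (s *: v + y) * h.
Proof.
move=> h0 df; pose g (s : R) := f (s *: v + y).
(* The ordinary derivative of [g] at [s] is the derivative of [f] along [v] at the point s v + y,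
   since (k + s) v + y = k v + (s v + y). *)
have line (s : R) := @eq_derive_line R R W g f s 1 (s *: v + y) v
  (fun k => congr1 f (etrans (congr1 (fun z => z + y) (scalerDl v (k *: 1) s))
    (etrans (esym (addrA _ _ _)) (congr1 (fun k => k *: v + _) (mulr1 k))))).
have dg s : 0 <= s <= h -> derivable g s 1 by move=> sh; rewrite (line s).2; exact: df.
have [||s] := @MVT R g (fun s => 'D_1 g s) 0 h h0.
- move=> s; rewrite in_itv /= => /andP[/ltW s0 /ltW sh].
  by apply: derivableP; apply: dg; rewrite s0.
- by apply: derivable_within_continuous => s; rewrite in_itv; exact: dg.
rewrite in_itv /= => /andP[/ltW s0 /ltW sh]; rewrite /g scale0r add0r subr0 => E.
by exists s; [rewrite s0|rewrite E (line s).1].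
Qed.

(** The second difference of [f] over the parallelogram at [x] with sides h v and h w is the
    increment along h v of g(y) = f(h w + y) - f(y). The mean value theorem is applied to [g] along
    [v], then to the derivative of [f] along [v] in the direction [w]. *)
Lemma mean_value_square f x v w (h : R) A : 0 < h ->
  (forall s t, 0 <= s <= h -> 0 <= t <= h -> A (t *: w + (s *: v + x))) ->
  (forall y, A y -> derivable f y v) ->
  (forall y, A y -> derivable ('D_v f) y w) ->
  exists s t, [/\ 0 <= s <= h, 0 <= t <= h &
    f (h *: w + (h *: v + x)) - f (h *: v + x) - (f (h *: w + x) - f x) =
    'D_w ('D_v f) (t *: w + (s *: v + x)) * h * h].
Proof.
move=> h0 Asq df ddf; pose g y := f (h *: w + y) - f y.
have hh : 0 <= h <= h by rewrite lexx ltW.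
have oh : 0 <= (0 : R) <= h by rewrite lexx ltW.
have shft y := @eq_derive_line R W W (fun y => f (h *: w + y)) f y v (h *: w + y) v
  (fun k => congr1 f (addrCA (h *: w) (k *: v) y)).
have Ah s : 0 <= s <= h -> A (h *: w + (s *: v + x)) by move=> sh; exact: Asq.
have A0 s : 0 <= s <= h -> A (s *: v + x).
  by move=> sh; have := Asq s 0 sh oh; rewrite scale0r add0r.
have dsh s : 0 <= s <= h -> derivable (fun y => f (h *: w + y)) (s *: v + x) v.
  by move=> sh; rewrite (shft _).2; apply: df; exact: Ah.
have [|s sh] := @mean_value_line g x v h h0.
  move=> s sh; apply: derivableB; first exact: dsh.
  by apply: df; exact: A0.
have -> : 'D_v g (s *: v + x) =
    'D_v f (h *: w + (s *: v + x)) - 'D_v f (s *: v + x).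
  by rewrite [LHS](deriveB (dsh _ sh) (df _ (A0 _ sh))) (shft _).1.
have [|t th ->] := @mean_value_line ('D_v f) (s *: v + x) w h h0.
  by move=> t th; apply: ddf; exact: Asq.
by exists s, t.
Qed.

(** The second difference is symmetric in [v] and [w]. Hence the two mixed derivatives take a common
    value at two points of an arbitrarily small parallelogram, and continuity at [x] makes them
    agree there up to any [e]. *)
Lemma schwarz f x v w A : open A -> A x ->
  (forall y, A y -> derivable f y v) -> (forall y, A y -> derivable f y w) ->
  (forall y, A y -> derivable ('D_v f) y w) ->
  (forall y, A y -> derivable ('D_w f) y v) ->
  {for x, continuous ('D_w ('D_v f))} -> {for x, continuous ('D_v ('D_w f))} ->
  'D_v ('D_w f) x = 'D_w ('D_v f) x.
Proof.
move=> oA Ax dv dw dvw dwv cvw cwv; apply/eqP; rewrite -subr_eq0 -normr_le0.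
apply/ler_addgt0Pr => e e0; rewrite add0r.
have e2 : 0 < e / 2 by rewrite divr_gt0.
have nA : nbhs x A by exact: open_nbhs_nbhs.
have nvw : \forall y \near x, `|'D_w ('D_v f) x - 'D_w ('D_v f) y| < e / 2.
  move/cvgrPdist_lt: cvw => /(_ _ e2). exact.
have nwv : \forall y \near x, `|'D_v ('D_w f) x - 'D_v ('D_w f) y| < e / 2.
  move/cvgrPdist_lt: cwv => /(_ _ e2). exact.
have [r /= r0 Hr] := (nbhs_normP _ _).1 (filterI nA (filterI nvw nwv)).
(* The parallelogram of size [h] stays within h c = r / 2 of [x]; the summand 1 keeps [c] positive
   when [v] and [w] vanish. *)
pose c := `|v| + `|w| + 1; have c0 : 0 < c by rewrite ltr_wpDl // addr_ge0.
pose h := r / c / 2; have h0 : 0 < h by rewrite !divr_gt0.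
have Hin s t : 0 <= s <= h -> 0 <= t <= h -> `|x - (t *: w + (s *: v + x))| < r.
  move=> /andP[s0 sh] /andP[t0 th].
  rewrite addrA opprD addrCA subrr addr0 normrN (le_lt_trans (ler_normD _ _)) //.
  rewrite !normrZ !ger0_norm // (@le_lt_trans _ _ (h * c)) //.
    have := normr_ge0 v; have := normr_ge0 w; rewrite /c; nra.
  by rewrite /h mulrAC divfK ?gt_eqF // ltr_pdivrMr // mulr_natr mulr2n ltrDl.
have [|s [t [sh th E]]] := @mean_value_square f x v w h A h0 _ dv dvw.
  by move=> s t sh th; have [] := Hr _ (Hin _ _ sh th).
have swap s' t' : s' *: v + (t' *: w + x) = t' *: w + (s' *: v + x) by rewrite addrCA.
have [|t' [s' [th' sh' E']]] := @mean_value_square f x w v h A h0 _ dw dwv.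
  by move=> t' s' th' sh'; rewrite swap; have [] := Hr _ (Hin _ _ sh' th').
(* Both sides times h^2 equal the same second difference. *)
have EE : 'D_v ('D_w f) (t' *: w + (s' *: v + x)) = 'D_w ('D_v f) (t *: w + (s *: v + x)).
  apply: (mulIf (lt0r_neq0 h0)); apply: (mulIf (lt0r_neq0 h0)).
  rewrite (swap s' t') (swap h h) in E'.
  refine (etrans (esym E') (etrans _ E)).
  by rewrite -!addrA; congr (_ + _); rewrite !opprB addrCA [RHS]addrC -addrA.
have [_ [_ +]] := Hr _ (Hin _ _ sh' th'); have [_ [+ _]] := Hr _ (Hin _ _ sh th).
rewrite EE => H1 H2.
by rewrite distrC; exact: ler_dist_half H1 H2.
Qed.

End Schwarz.

Lemma partialC (R : realType) m (i j : 'I_m) (V : set 'rV[R]_m) f x :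
  open V -> V x -> Ck 2 V f ->
  partial i (partial j f) x = partial j (partial i f) x.
Proof.
move=> oV Vx [_ Hf]; have [di [_ Hi]] := Hf i; have [dj [_ Hj]] := Hf j.
apply: (@schwarz R _ f x (delta_mx 0 i) (delta_mx 0 j) V oV Vx di dj).
- by case: (Hi j).
- by case: (Hj i).
- by have [_ [+ _]] := Hi j; exact.
- by have [_ [+ _]] := Hj i; exact.
Qed.

(** * Curvature and Ricci tensor in terms of Christoffel symbols *)

Section CurvatureFormula.
Variables (R : realType) (m : nat) (G : 'rV[R]_m -> 'M[R]_m).
Implicit Types (Y : 'rV[R]_m -> 'rV[R]_m) (x : 'rV[R]_m).
Local Notation Gamma := (christoffel G).
Local Notation e := (@frame R m).

Lemma sum_frame (i : 'I_m) (f : 'I_m -> R) x :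
  \sum_j e i x 0 j * f j = f i.
Proof.
rewrite (bigD1 i) //= mxE !eqxx mul1r big1 ?addr0 // => j ji.
by rewrite mxE eqxx (negPf ji) mul0r.
Qed.

Lemma nabla_frame (i l : 'I_m) Y x :
  nabla G (e i) Y x 0 l =
  partial i (fun y => Y y 0 l) x + \sum_j Gamma l i j x * Y x 0 j.
Proof. by rewrite mxE sum_frame. Qed.

Lemma nabla_frames (i j l : 'I_m) x :
  nabla G (e i) (e j) x 0 l = Gamma l i j x.
Proof.
rewrite nabla_frame partial_cst add0r.
by under eq_bigr do rewrite mulrC; rewrite sum_frame.
Qed.

Lemma lie_bracket_frame (i j : 'I_m) : lie_bracket (e i) (e j) = fun=> 0.
Proof.
apply/funext => x; apply/rowP => k /=; rewrite [RHS]mxE mxE big1 // => l _.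
by rewrite !partial_cst !mulr0 subrr.
Qed.

Lemma nabla_cst0 Y x : nabla G (fun=> 0) Y x = 0.
Proof. by apply/rowP => k; rewrite [RHS]mxE mxE big1 // => i _; rewrite mxE mul0r. Qed.

(** Coordinate fields commute, so the bracket term drops out and the classical coordinate formula
    for the curvature remains. *)
Lemma curvature_frame (k i j l : 'I_m) x :
  curvature G (e k) (e i) (e j) x 0 l =
  partial k (Gamma l i j) x - partial i (Gamma l k j) x +
  \sum_s (Gamma l k s x * Gamma s i j x - Gamma l i s x * Gamma s k j x).
Proof.
rewrite /curvature lie_bracket_frame nabla_cst0 subr0 mxE [X in _ + X]mxE !nabla_frame.
have E (a b : 'I_m) : (fun y => nabla G (e a) (e b) y 0 l) = Gamma l a b.
  by apply/funext => y; exact: nabla_frames.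
rewrite !E sumrB opprD addrACA; congr (_ + (_ - _)).
  by apply: eq_bigr => s _; rewrite nabla_frames.
by apply: eq_bigr => s _; rewrite nabla_frames.
Qed.

Lemma ricci_localE (i j : 'I_m) x :
  ricci_local G x i j = \sum_k (partial k (Gamma k i j) x - partial i (Gamma k k j) x +
  \sum_s (Gamma k k s x * Gamma s i j x - Gamma k i s x * Gamma s k j x)).
Proof.
by rewrite !mxE; apply: eq_bigr => k _; rewrite mxE curvature_frame.
Qed.

End CurvatureFormula.

(** * The Levi-Civita connection of a metric in a chart *)

Section Metric.
Variables (R : realType) (m : nat) (G : 'rV[R]_m -> 'M[R]_m) (V : set 'rV[R]_m).
Hypotheses (V_open : open V)
  (G_smooth : forall i j, smooth_on V (fun x => G x i j))
  (G_sym : forall x, V x -> (G x)^T = G x)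
  (G_unit : forall x, V x -> G x \in unitmx).
Implicit Types (x : 'rV[R]_m).
Local Notation Gamma := (christoffel G).

Lemma metric_derivable (k i j : 'I_m) x : V x ->
  derivable (fun y => G y i j) x (delta_mx 0 k).
Proof. exact: smooth_derivable. Qed.

Lemma partial_metricC (k i j : 'I_m) x : V x ->
  partial k (fun y => G y i j) x = partial k (fun y => G y j i) x.
Proof.
move=> Vx; apply: (partial_ext _ V_open Vx) => y /[!inE] Vy.
by rewrite -[in LHS](G_sym Vy) mxE.
Qed.

Lemma invmx_metric_derivable (k i j : 'I_m) x : V x ->
  derivable (fun y => invmx (G y) i j) x (delta_mx 0 k).
Proof.
move=> Vx; apply: derivable_invmx.
  by apply: (@filterS _ (nbhs x) _ V) => //; exact: open_nbhs_nbhs.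
by move=> a b; exact: metric_derivable.
Qed.

Lemma christoffelC (l i j : 'I_m) x : V x -> Gamma l i j x = Gamma l j i x.
Proof.
move=> Vx; congr (_ * _); apply: eq_bigr => t _; congr (_ * _).
by rewrite [partial t _ _]partial_metricC // [X in X - _]addrC.
Qed.

Lemma christoffel_derivable (k l i j : 'I_m) x : V x ->
  derivable (Gamma l i j) x (delta_mx 0 k).
Proof.
move=> Vx; apply: derivableM; first exact: derivable_cst.
apply: derivable_bigsum => t _; apply: derivableM.
  exact: invmx_metric_derivable.
have dd a b c : derivable (partial a (fun y => G y b c)) x (delta_mx 0 k).
  by apply: smooth_derivable Vx; apply: smooth_partial.
by apply: derivableB; [apply: derivableD|]; exact: dd.
Qed.

(** The connection matrix in direction [k]. Its row is the upper index, so it acts on column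
    vectors. *)
Definition christoffel_mx (k : 'I_m) x : 'M[R]_m := \matrix_(l, i) Gamma l k i x.

(** Lowering the upper index cancels the inverse metric and leaves the Christoffel symbols of the
    first kind. *)
Lemma metric_christoffel (k i j : 'I_m) x : V x ->
  (G x *m christoffel_mx k x) j i =
  2^-1 * (partial k (fun y => G y i j) x + partial i (fun y => G y k j) x
          - partial j (fun y => G y k i) x).
Proof.
move=> Vx; pose L := \matrix_(l, a) (partial k (fun y => G y a l) x
  + partial a (fun y => G y k l) x - partial l (fun y => G y k a) x).
have -> : christoffel_mx k x = 2^-1 *: (invmx (G x) *m L).
  apply/matrixP => a b; rewrite !mxE; congr (_ * _).
  by apply: eq_bigr => t _; rewrite !mxE.
by rewrite -scalemxAr mulKVmx ?G_unit // !mxE.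
Qed.

(* The Levi-Civita connection is metric. *)
Lemma partial_metric (k : 'I_m) x : V x ->
  partial_mx k G x = (christoffel_mx k x)^T *m G x + G x *m christoffel_mx k x.
Proof.
move=> Vx; rewrite -{1}(G_sym Vx) -trmx_mul; apply/matrixP => i j.
rewrite [RHS]mxE [X in X + _]mxE !metric_christoffel // mxE.
rewrite (partial_metricC k j i) //.
by field.
Qed.

Lemma partial_inv_metric (k : 'I_m) x : V x ->
  partial_mx k (fun y => invmx (G y)) x =
  - (invmx (G x) *m (christoffel_mx k x)^T + christoffel_mx k x *m invmx (G x)).
Proof.
move=> Vx; rewrite (partial_invmx V_open) //; last by move=> a b; exact: metric_derivable.
rewrite partial_metric // mulmxDr mulmxDl !mulmxA mulVmx ?G_unit // mul1mx.
by rewrite mulmxK ?G_unit.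
Qed.

(** The divergence of the gradient is the trace of the Hessian. Differentiating the inverse metric
    yields two Christoffel terms: one cancels the connection term of the divergence, the other is
    the correction term of the Hessian. *)
Lemma div_grad (f : 'rV[R]_m -> R) x : V x ->
  (forall c d : 'I_m, derivable (partial d f) x (delta_mx 0 c)) ->
  \sum_c (partial c (fun y => \sum_d invmx (G y) c d * partial d f y) x
    + \sum_d Gamma c c d x * \sum_e invmx (G x) d e * partial e f x) =
  metric_trace G x (hessian G f x).
Proof.
move=> Vx ddf.
have dE c : partial c (fun y => \sum_d invmx (G y) c d * partial d f y) x =
   \sum_d (invmx (G x) c d * partial c (partial d f) x
     - (\sum_l invmx (G x) c l * Gamma d c l x) * partial d f x
     - (\sum_l Gamma c c l x * invmx (G x) l d) * partial d f x).
  rewrite /partial derive_bigsum; last first.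
    by move=> d _; apply: derivableM; [exact: invmx_metric_derivable|exact: ddf].
  apply: eq_bigr => d _; rewrite deriveM; [|exact: invmx_metric_derivable|exact: ddf].
  have /matrixP/(_ c d) := partial_inv_metric c Vx; rewrite !mxE /partial => ->.
  rewrite -[_ *: _]/(_ * _) -[X in _ + X]/(_ * _) mulrN mulrDr opprD addrA.
  congr (_ - _ - _).
    by rewrite mulrC; congr (_ * _); apply: eq_bigr => l _; rewrite !mxE.
  by rewrite mulrC; congr (_ * _); apply: eq_bigr => l _; rewrite !mxE.
under eq_bigr => c _.
  rewrite dE sumrB.
  have -> : \sum_d (\sum_l Gamma c c l x * invmx (G x) l d) * partial d f x =
            \sum_d Gamma c c d x * \sum_e invmx (G x) d e * partial e f x.
    under eq_bigr do rewrite mulr_suml.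
    rewrite exchange_big; apply: eq_bigr => d _; rewrite mulr_sumr.
    by apply: eq_bigr => e _; rewrite mulrA.
  rewrite subrK.
  over.
rewrite /metric_trace; under eq_bigr do rewrite sumrB.
under [RHS]eq_bigr do (under eq_bigr do rewrite mxE mulrBr; rewrite sumrB).
rewrite !sumrB; congr (_ - _); apply: eq_bigr => c _.
under eq_bigr do rewrite mulr_suml.
rewrite exchange_big; apply: eq_bigr => d _; rewrite mulr_sumr.
by apply: eq_bigr => t _; rewrite -mulrA.
Qed.

End Metric.

(** * Partial derivatives and inverse matrices in product coordinates *)

Section Product.
Variables (R : realType) (m1 m2 : nat).
Implicit Types (x : 'rV[R]_(m1 + m2)) (g : 'rV[R]_m1 -> R) (h : 'rV[R]_m2 -> R).

Lemma partial_lsubmxM (i : 'I_m1) g h x : derivable g (lsubmx x) (delta_mx 0 i) ->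
  partial (lshift m2 i) (fun y => g (lsubmx y) * h (rsubmx y)) x =
  partial i g (lsubmx x) * h (rsubmx x).
Proof.
move=> dg; rewrite /partial deriveM; last exact: (@derivable_rsubmx0 R m1 m2 i h x).
  rewrite -[X in _ *: X + _]/(partial _ _ _) (partial_rsubmx0 i h) scaler0 add0r.
  by rewrite -[X in _ *: X]/(partial _ _ _) (partial_lsubmx _ _ g) mulrC.
exact: (derivable_lsubmx dg).
Qed.

Lemma partial_rsubmxM (i : 'I_m2) g h x : derivable h (rsubmx x) (delta_mx 0 i) ->
  partial (rshift m1 i) (fun y => g (lsubmx y) * h (rsubmx y)) x =
  g (lsubmx x) * partial i h (rsubmx x).
Proof.
move=> dh; rewrite /partial deriveM; first last.
- exact: (derivable_rsubmx dh).
- exact: (@derivable_lsubmx0 R m1 m2 i g x).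
rewrite -[X in _ + _ *: X]/(partial _ _ _) (partial_lsubmx0 i g) scaler0 addr0.
by rewrite -[X in _ *: X]/(partial _ _ _) (partial_rsubmx _ _ h).
Qed.

Lemma invmx_block_diag (A : 'M[R]_m1) (B : 'M[R]_m2) :
  A \in unitmx -> B \in unitmx ->
  invmx (block_mx A 0 0 B) = block_mx (invmx A) 0 0 (invmx B).
Proof.
move=> uA uB; have E : block_mx A 0 0 B *m block_mx (invmx A) 0 0 (invmx B) = 1%:M.
  by rewrite mulmx_block !(mul0mx, mulmx0, addr0, add0r) !mulmxV // -scalar_mx_block.
have uAB : block_mx A 0 0 B \in unitmx by have [] := mulmx1_unit E.
by rewrite -[LHS]mulmx1 -E mulKmx.
Qed.

End Product.

(** * Christoffel symbols and Ricci tensor of a warped metric *)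

Lemma sum_mulr_eq (R : pzRingType) (I : finType) (a : I) (F : I -> R) (c : R) :
  \sum_i F i * (c * (i == a)%:R) = F a * c.
Proof.
rewrite (bigD1 a) //= eqxx mulr1 big1 ?addr0 // => i /negPf ->.
by rewrite !mulr0.
Qed.

Section WarpedMetric.
Variables (R : realType) (m1 m2 : nat).
Variables (B : 'rV[R]_m1 -> 'M[R]_m1) (H : 'rV[R]_m2 -> 'M[R]_m2) (f : 'rV[R]_m1 -> R).
Variables (V : set 'rV[R]_m1) (W : set 'rV[R]_m2).
Hypotheses (V_open : open V) (W_open : open W).
Hypotheses (B_smooth : forall i j, smooth_on V (fun u => B u i j))
  (B_sym : forall u, V u -> (B u)^T = B u) (B_unit : forall u, V u -> B u \in unitmx).
Hypotheses (H_smooth : forall i j, smooth_on W (fun u => H u i j))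
  (H_sym : forall u, W u -> (H u)^T = H u) (H_unit : forall u, W u -> H u \in unitmx).
Hypotheses (f_smooth : smooth_on V f) (f_neq0 : forall u, V u -> f u != 0).

Definition warped_metric (x : 'rV[R]_(m1 + m2)) : 'M[R]_(m1 + m2) :=
  block_mx (B (lsubmx x)) 0 0 (f (lsubmx x) *: H (rsubmx x)).
Local Notation Gm := (christoffel warped_metric).
Local Notation lft := (lshift m2).
Local Notation rgt := (rshift m1).

Let U : set 'rV[R]_(m1 + m2) := [set x | V (lsubmx x) /\ W (rsubmx x)].

Let U_open : open U.
Proof.
apply: openI.
  by apply: open_comp V_open => x _; exact: continuous_lsubmx.
by apply: open_comp W_open => x _; exact: continuous_rsubmx.
Qed.

Let G_sym x : U x -> (warped_metric x)^T = warped_metric x.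
Proof.
by case=> Vx Wx; rewrite /warped_metric tr_block_mx !trmx0 linearZ /= B_sym // H_sym.
Qed.

Let fdx (c : 'I_m1) u : V u -> derivable f u (delta_mx 0 c).
Proof. exact: smooth_derivable. Qed.

Let Hdx (c a b : 'I_m2) u : W u -> derivable (fun u => H u a b) u (delta_mx 0 c).
Proof. exact: smooth_derivable. Qed.

Let Gll a b : (fun x => warped_metric x (lft a) (lft b)) = fun x => B (lsubmx x) a b.
Proof. by apply/funext => x; rewrite /warped_metric block_mxEul. Qed.
Let Glr a b : (fun x => warped_metric x (lft a) (rgt b)) = fun=> 0.
Proof. by apply/funext => x; rewrite /warped_metric block_mxEur mxE. Qed.
Let Grl a b : (fun x => warped_metric x (rgt a) (lft b)) = fun=> 0.
Proof. by apply/funext => x; rewrite /warped_metric block_mxEdl mxE. Qed.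
Let Grr a b : (fun x => warped_metric x (rgt a) (rgt b)) =
  fun x => f (lsubmx x) * H (rsubmx x) a b.
Proof. by apply/funext => x; rewrite /warped_metric block_mxEdr mxE. Qed.

Let lGll c a b x : partial (lft c) (fun x => warped_metric x (lft a) (lft b)) x =
  partial c (fun u => B u a b) (lsubmx x).
Proof. by rewrite Gll (partial_lsubmx _ _ (fun u => B u a b)). Qed.
Let rGll c a b x : partial (rgt c) (fun x => warped_metric x (lft a) (lft b)) x = 0.
Proof. by rewrite Gll (partial_lsubmx0 _ (fun u => B u a b)). Qed.
Let Glr0 c a b x : partial c (fun x => warped_metric x (lft a) (rgt b)) x = 0.
Proof. by rewrite Glr partial_cst. Qed.
Let Grl0 c a b x : partial c (fun x => warped_metric x (rgt a) (lft b)) x = 0.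
Proof. by rewrite Grl partial_cst. Qed.
Let lGrr c a b x : U x ->
  partial (lft c) (fun x => warped_metric x (rgt a) (rgt b)) x =
  partial c f (lsubmx x) * H (rsubmx x) a b.
Proof.
by case=> Vx _; rewrite Grr (partial_lsubmxM (fun u => H u a b)) //; exact: fdx.
Qed.
Let rGrr c a b x : U x ->
  partial (rgt c) (fun x => warped_metric x (rgt a) (rgt b)) x =
  f (lsubmx x) * partial c (fun u => H u a b) (rsubmx x).
Proof.
by case=> _ Wx; rewrite Grr (partial_rsubmxM f (h := fun u => H u a b)) //; exact: Hdx.
Qed.

Let invG x : U x -> invmx (warped_metric x) =
  block_mx (invmx (B (lsubmx x))) 0 0 ((f (lsubmx x))^-1 *: invmx (H (rsubmx x))).
Proof.
case=> Vx Wx; have fx : f (lsubmx x) \is a GRing.unit by rewrite unitfE f_neq0.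
rewrite invmx_block_diag ?B_unit // ?unitmxZ ?H_unit // invmxZ //.
by rewrite unitmxZ ?H_unit.
Qed.

Let sum_invG_l c (F : 'I_(m1 + m2) -> R) x : U x ->
  \sum_l invmx (warped_metric x) (lft c) l * F l =
  \sum_d invmx (B (lsubmx x)) c d * F (lft d).
Proof.
move=> Ux; rewrite big_split_ord /= invG // [X in _ + X]big1 ?addr0.
  by apply: eq_bigr => d _; rewrite block_mxEul.
by move=> d _; rewrite block_mxEur mxE mul0r.
Qed.
Let sum_invG_r c (F : 'I_(m1 + m2) -> R) x : U x ->
  \sum_l invmx (warped_metric x) (rgt c) l * F l =
  (f (lsubmx x))^-1 * \sum_d invmx (H (rsubmx x)) c d * F (rgt d).
Proof.
move=> Ux; rewrite big_split_ord /= invG // [X in X + _]big1 ?add0r.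
  by rewrite mulr_sumr; apply: eq_bigr => d _; rewrite block_mxEdr mxE mulrA.
by move=> d _; rewrite block_mxEdl mxE mul0r.
Qed.

(* The suffix gives the factors (left: base, right: fibre) of the three indices,
   the upper one first: [christoffel_lrr] is Gamma^c_(alpha beta). *)
Let christoffel_lll c a b x : U x ->
  Gm (lft c) (lft a) (lft b) x = christoffel B c a b (lsubmx x).
Proof.
move=> Ux; rewrite /christoffel sum_invG_l //; congr (_ * _).
by apply: eq_bigr => d _; rewrite !lGll.
Qed.

Let christoffel_rll c a b x : U x -> Gm (rgt c) (lft a) (lft b) x = 0.
Proof.
move=> Ux; rewrite /christoffel sum_invG_r // big1 ?mulr0 // => d _.
by rewrite !Glr0 rGll addr0 subrr mulr0.
Qed.

Let christoffel_lrl c a b x : U x -> Gm (lft c) (rgt a) (lft b) x = 0.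
Proof.
move=> Ux; rewrite /christoffel sum_invG_l // big1 ?mulr0 // => d _.
by rewrite rGll !Grl0 addr0 subrr mulr0.
Qed.

Let christoffel_llr c a b x : U x -> Gm (lft c) (lft a) (rgt b) x = 0.
Proof. by move=> Ux; rewrite (christoffelC U_open G_sym) // christoffel_lrl. Qed.

Let christoffel_rlr c a b x : U x -> Gm (rgt c) (lft a) (rgt b) x =
  (2 * f (lsubmx x))^-1 * partial a f (lsubmx x) * (c == b)%:R.
Proof.
move=> Ux; have [Vx Wx] := Ux; rewrite /christoffel sum_invG_r //.
under eq_bigr => d _.
  rewrite lGrr // !Glr0 subr0 addr0 -{2}(H_sym Wx) mxE mulrCA; over.
rewrite -mulr_sumr.
have /matrixP/(_ c b) := mulVmx (H_unit Wx); rewrite !mxE => ->.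
by rewrite invfM !mulrA.
Qed.

Let christoffel_rrl c a b x : U x -> Gm (rgt c) (rgt a) (lft b) x =
  (2 * f (lsubmx x))^-1 * partial b f (lsubmx x) * (c == a)%:R.
Proof. by move=> Ux; rewrite (christoffelC U_open G_sym) // christoffel_rlr. Qed.

Let grad c u := \sum_d invmx (B u) c d * partial d f u.

Let christoffel_lrr c a b x : U x -> Gm (lft c) (rgt a) (rgt b) x =
  (- 2^-1 * grad c (lsubmx x)) * H (rsubmx x) a b.
Proof.
move=> Ux; rewrite /christoffel sum_invG_l // mulNr -mulrN -mulrA; congr (_ * _).
rewrite /grad mulNr mulr_suml -sumrN; apply: eq_bigr => d _.
by rewrite lGrr // !Grl0 addr0 sub0r mulrN mulrA.
Qed.

Let christoffel_rrr c a b x : U x ->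
  Gm (rgt c) (rgt a) (rgt b) x = christoffel H c a b (rsubmx x).
Proof.
move=> Ux; have [Vx Wx] := Ux; rewrite /christoffel sum_invG_r //; congr (_ * _).
rewrite mulr_sumr; apply: eq_bigr => d _; rewrite !rGrr // -mulrDr -mulrBr.
by rewrite mulrCA mulKf ?f_neq0.
Qed.

(** The formulas for the Christoffel symbols hold on [U] only; since [U] is open, they may still be
    differentiated at its points. *)
Let partial_U i (h1 h2 : 'rV[R]_(m1 + m2) -> R) x : U x ->
  (forall y, U y -> h1 y = h2 y) -> partial i h1 x = partial i h2 x.
Proof. by move=> Ux E; apply: (partial_ext _ U_open) => // y /[!inE]; exact: E. Qed.

(** The symbols that are differentiated along the fibre depend on the base point alone. Among the
    quadratic terms only those with all summation indices in the fibre survive, and they cancel by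
    the symmetry of the fibre Christoffel symbols. *)
Lemma ricci_warped_rl a b x : V (lsubmx x) -> W (rsubmx x) ->
  ricci_local warped_metric x (rgt a) (lft b) = 0.
Proof.
move=> Vx Wx; have Ux : U x by [].
pose p b u := (2 * f u)^-1 * partial b f u.
rewrite ricci_localE big_split_ord /= [X in X + _]big1 ?add0r => [|c _]; last first.
  rewrite (partial_U _ Ux (christoffel_lrl c a b)) partial_cst.
  rewrite (partial_U _ Ux (christoffel_lll c c b)) partial_lsubmx0.
  rewrite big_split_ord /= !big1 ?addr0 ?subr0 // => s _.
    by rewrite christoffel_llr // christoffel_rll // mulr0 mul0r subrr.
  by rewrite !christoffel_lrl // mulr0 mul0r subrr.
have dp c d y : U y -> Gm (rgt c) (rgt d) (lft b) y = (p b (lsubmx y)) * (c == d)%:R.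
  exact: christoffel_rrl.
rewrite big1 // => c _.
rewrite (partial_U _ Ux (dp c a)) (partial_U _ Ux (dp c c)).
rewrite (partial_lsubmx0 c (fun u => p b u * (c == a)%:R)).
rewrite (partial_lsubmx0 a (fun u => p b u * (c == c)%:R)) subrr add0r.
rewrite big_split_ord /= big1 ?add0r => [|d _]; last first.
  by rewrite !christoffel_lrl // !mulr0 subrr.
under eq_bigr => d _ do rewrite !dp // !christoffel_rrr //.
by rewrite sumrB !sum_mulr_eq (christoffelC W_open H_sym) // subrr.
Qed.

Let grad_derivable c d u : V u -> derivable (grad d) u (delta_mx 0 c).
Proof.
move=> Vu; apply: derivable_bigsum => e _; apply: derivableM.
  exact: (invmx_metric_derivable V_open B_smooth B_unit).
by apply: smooth_derivable Vu; exact: smooth_partial.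
Qed.

Let sum_grad u : \sum_c grad c u * partial c f u = gradient_sq B f u.
Proof.
apply: eq_bigr => c _; rewrite mulr_suml; apply: eq_bigr => d _.
by rewrite mxE -mulrA [partial d f u * _]mulrC.
Qed.

(** The contracted index runs over the base, then over the fibre. The two sums contribute 1/2 and
    -(m2 - 1)/2 times the gradient term, hence the factor m2 - 2. *)
Lemma ricci_warped_rr a b x : V (lsubmx x) -> W (rsubmx x) ->
  ricci_local warped_metric x (rgt a) (rgt b) =
  ricci_local H (rsubmx x) a b - 2^-1 *
   (metric_trace B (lsubmx x) (hessian B f (lsubmx x))
    + (m2%:R - 2) * (2 * f (lsubmx x))^-1 * gradient_sq B f (lsubmx x))
   * H (rsubmx x) a b.
Proof.
move=> Vx Wx; have Ux : U x by [].
set u := lsubmx x; set v := rsubmx x.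
have E1 c d : Gm (lft c) (rgt d) (rgt b) x = - 2^-1 * grad c u * H v d b.
  exact: christoffel_lrr.
have E2 c d e : Gm (rgt c) (rgt d) (lft e) x = (2 * f u)^-1 * partial e f u * (c == d)%:R.
  exact: christoffel_rrl.
have E3 c d e : Gm (rgt c) (lft d) (rgt e) x = (2 * f u)^-1 * partial d f u * (c == e)%:R.
  exact: christoffel_rlr.
(* Here [S] is the scalar Delta_1 F / (2F), not the Ricci tensor. *)
pose S := (2 * f u)^-1 * gradient_sq B f u.
rewrite ricci_localE big_split_ord /=.
(* Base values of the contracted index. By [div_grad], the derivative term and the products with [s]
   in the base give the trace of the Hessian; the products with [s] in the fibre give the term in
   [S]. *)
have L : \sum_c (partial (lft c) (Gm (lft c) (rgt a) (rgt b)) x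
      - partial (rgt a) (Gm (lft c) (lft c) (rgt b)) x
      + \sum_s (Gm (lft c) (lft c) s x * Gm s (rgt a) (rgt b) x
                - Gm (lft c) (rgt a) s x * Gm s (lft c) (rgt b) x)) =
    - 2^-1 * metric_trace B u (hessian B f u) * H v a b + 2^-1 * S * H v a b.
  rewrite -(div_grad V_open B_smooth B_sym B_unit) //; last first.
    by move=> c d; apply: smooth_derivable Vx; exact: smooth_partial.
  rewrite /S -sum_grad !(mulr_sumr, mulr_suml) -big_split; apply: eq_bigr => c _ /=.
  rewrite (partial_U _ Ux (christoffel_llr c c b)) partial_cst subr0.
  rewrite (partial_U _ Ux (christoffel_lrr c a b)).
  rewrite (partial_lsubmxM (g := fun u => - 2^-1 * grad c u) (fun v => H v a b)); last first.
    by apply: derivableM; [exact: derivable_cst|exact: grad_derivable].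
  rewrite /partial deriveM; [|exact: derivable_cst|exact: grad_derivable].
  rewrite derive_cst scaler0 addr0 -[_ *: _]/(_ * _) -!/(partial _ _ _) -/u -/v.
  rewrite mulrDr mulrDl -addrA; congr (_ + _).
  rewrite big_split_ord /=; congr (_ + _).
    rewrite mulr_sumr mulr_suml; apply: eq_bigr => d _.
    rewrite christoffel_lll // christoffel_lrl // mul0r subr0 E1 -/u -/(grad d u); ring.
  under eq_bigr => d _ do rewrite christoffel_llr // mul0r sub0r E3 christoffel_lrr //.
  rewrite sumrN sum_mulr_eq -/u -/v; ring.
(* Fibre values of the contracted index. Purely fibre terms form the Ricci tensor of [H]. The
   products with [s] in the base give -1/2 [S] for each of the m2 values of [c], and one such term
   is returned when c = a. *)
have M : \sum_c (partial (rgt c) (Gm (rgt c) (rgt a) (rgt b)) x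
      - partial (rgt a) (Gm (rgt c) (rgt c) (rgt b)) x
      + \sum_s (Gm (rgt c) (rgt c) s x * Gm s (rgt a) (rgt b) x
                - Gm (rgt c) (rgt a) s x * Gm s (rgt c) (rgt b) x)) =
    ricci_local H v a b - 2^-1 * (m2%:R - 1) * S * H v a b.
  transitivity (\sum_c ((partial c (christoffel H c a b) v
      - partial a (christoffel H c c b) v
      + \sum_s (christoffel H c c s v * christoffel H s a b v
                - christoffel H c a s v * christoffel H s c b v))
      + (- 2^-1 * S * H v a b - - 2^-1 * S * H v c b * (c == a)%:R))).
    apply: eq_bigr => c _.
    rewrite (partial_U _ Ux (christoffel_rrr c a b)).
    rewrite (partial_U _ Ux (christoffel_rrr c c b)).
    rewrite !(partial_rsubmx _ _ (christoffel H _ _ _)) -/v -[RHS]addrA; congr (_ + _).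
    rewrite big_split_ord /= addrC; congr (_ + _).
      by apply: eq_bigr => d _; rewrite !christoffel_rrr.
    rewrite /S -sum_grad !(mulr_sumr, mulr_suml) -sumrB; apply: eq_bigr => d _.
    rewrite !E1 !E2 eqxx mulr1; move: (c == a)%:R => k; ring.
  rewrite big_split /= -ricci_localE; congr (_ + _).
  rewrite sumrB sumr_const card_ord -mulr_natr.
  rewrite (bigD1 a) //= eqxx mulr1 big1 ?addr0 => [|c /negPf ->]; last exact: mulr0.
  ring.
rewrite L M /S; ring.
Qed.

End WarpedMetric.

(** * Skew-adjointness of the curvature operators *)

Lemma partial_mxE (R : realType) m p q (i : 'I_m) (A : 'rV[R]_m -> 'M[R]_(p, q)) x a b :
  partial_mx i A x a b = partial i (fun y => A y a b) x.
Proof. by rewrite mxE. Qed.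

(** Meant for A = C_k, B = C_i, X and Y the derivatives of C_i along [k] and of C_k along [i].
    Adding and subtracting A^T G B and B^T G A completes the derivatives of G C_i and G C_k, because
    A^T G + G A is the derivative of the metric. *)
Lemma lowered_curvature_mx (R : comPzRingType) m (X Y A B G : 'M[R]_m) :
  G *m (X - Y + (A *m B - B *m A)) =
  (A^T *m G + G *m A) *m B + G *m X - ((B^T *m G + G *m B) *m A + G *m Y)
  - (A^T *m G *m B - B^T *m G *m A).
Proof.
rewrite !mulmxDl mulmxDr !mulmxBr !mulmxA.
move: (G *m X) (G *m Y) (G *m A *m B) (G *m B *m A) (A^T *m G *m B) (B^T *m G *m A).
move=> {X Y A B G} X Y S T P Q; rewrite !opprD !opprK.
apply/matrixP => i j; rewrite !mxE; ring.
Qed.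

Section CurvatureSkew.
Variables (R : realType) (m : nat) (G : 'rV[R]_m -> 'M[R]_m) (V : set 'rV[R]_m).
Hypotheses (V_open : open V)
  (G_smooth : forall i j, smooth_on V (fun x => G x i j))
  (G_sym : forall x, V x -> (G x)^T = G x)
  (G_unit : forall x, V x -> G x \in unitmx).
Implicit Types (x : 'rV[R]_m).
Local Notation C := (christoffel_mx G).

(** The matrix of the operator R(e_k, e_i) on column vectors, written with the connection
    matrices. *)
Definition curvature_mx (k i : 'I_m) x : 'M[R]_m :=
  partial_mx k (C i) x - partial_mx i (C k) x + (C k x *m C i x - C i x *m C k x).

Lemma curvature_mxE (k i j l : 'I_m) x : curvature_mx k i x l j =
  partial k (christoffel G l i j) x - partial i (christoffel G l k j) x +
  \sum_s (christoffel G l k s x * christoffel G s i j x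
          - christoffel G l i s x * christoffel G s k j x).
Proof.
rewrite !mxE; congr (_ - _ + _).
- by congr (partial k _ x); apply/funext => y; rewrite mxE.
- by congr (partial i _ x); apply/funext => y; rewrite mxE.
- by rewrite sumrB; congr (_ - _); apply: eq_bigr => s _; rewrite !mxE.
Qed.

Lemma curvature_mxN (k i : 'I_m) x : curvature_mx k i x = - curvature_mx i k x.
Proof. by rewrite /curvature_mx opprD !opprB. Qed.

Lemma curvature_mx_diag (k : 'I_m) x : curvature_mx k k x = 0.
Proof. by rewrite /curvature_mx !subrr addr0. Qed.

Lemma partial_mxC (k i : 'I_m) x : V x ->
  partial_mx k (partial_mx i G) x = partial_mx i (partial_mx k G) x.
Proof.
move=> Vx; apply/matrixP => a b.
apply: etrans (partial_mxE k (partial_mx i G) x a b) _.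
apply: etrans (esym (partial_mxE i (partial_mx k G) x a b)).
have E (c : 'I_m) : (fun y => partial_mx c G y a b) = partial c (fun y => G y a b).
  by apply/funext => y; rewrite mxE.
rewrite !E; apply: (partialC _ _ V_open Vx); exact: (G_smooth a b 2%N).
Qed.

(* The curvature operators are skew-adjoint: differentiate
   [partial_i G = C_i^T G + G C_i] once more and antisymmetrize. *)
Lemma curvature_mx_skew (k i : 'I_m) x : V x ->
  (G x *m curvature_mx k i x)^T = - (G x *m curvature_mx k i x).
Proof.
move=> Vx; pose L c y := G y *m C c y.
have dG c y a b : V y -> derivable (fun z => G z a b) y (delta_mx 0 c).
  exact: (metric_derivable G_smooth).
have dC c d y a b : V y -> derivable (fun z => C d z a b) y (delta_mx 0 c).
  move=> Vy; under [X in derivable X]eq_fun do rewrite mxE.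
  exact: (christoffel_derivable V_open G_smooth G_unit).
have dL c d a b : derivable (fun z => L d z a b) x (delta_mx 0 c).
  under [X in derivable X]eq_fun do rewrite mxE.
  by apply: derivable_bigsum => e _; apply: derivableM; [exact: dG|exact: dC].
have LE c d : partial_mx c (L d) x =
    partial_mx c G x *m C d x + G x *m partial_mx c (C d) x.
  by apply: partial_mxM => a b; [exact: dG|exact: dC].
have ddG c d : partial_mx c (partial_mx d G) x =
    (partial_mx c (L d) x)^T + partial_mx c (L d) x.
  apply/matrixP => a b; rewrite !mxE.
  rewrite (partial_ext c (g := fun y => L d y b a + L d y a b) V_open Vx).
    by rewrite /partial deriveD //; exact: dL.
  move=> y /[!inE] Vy; rewrite (partial_metric V_open G_sym G_unit) //.
  by rewrite -{1}(G_sym Vy) -trmx_mul [LHS]mxE [X in X + _]mxE.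
(* The second derivatives of [G] along [k] and [i] commute; by [ddG] this equates the symmetric
   parts of the two derivatives. *)
have DT : (partial_mx k (L i) x - partial_mx i (L k) x)^T =
    - (partial_mx k (L i) x - partial_mx i (L k) x).
  have := partial_mxC k i Vx; rewrite !ddG linearB /=.
  move: (partial_mx k _ _) (partial_mx i _ _) => X Y XY.
  by rewrite opprB; apply/eqP; rewrite subr_eq addrAC [Y + _]addrC -XY addrK.
have GK : G x *m curvature_mx k i x = partial_mx k (L i) x - partial_mx i (L k) x
    - ((C k x)^T *m G x *m C i x - (C i x)^T *m G x *m C k x).
  rewrite !LE !(partial_metric V_open G_sym G_unit) // /curvature_mx.
  move: (partial_mx k (C i) x) (partial_mx i (C k) x) (C k x) (C i x) (G x).
  exact: lowered_curvature_mx.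
(* The remaining difference is skew too: transposition exchanges C_k^T G C_i and C_i^T G C_k. *)
rewrite GK [LHS]linearB /= DT [X in _ - X]linearB /= !trmx_mul !trmxK G_sym // !mulmxA.
by rewrite [RHS]opprB [RHS]addrC; congr (_ + _); rewrite opprB.
Qed.

End CurvatureSkew.

(** * Surfaces are Einstein *)

Lemma det22 (R : comNzRingType) (A : 'M[R]_2) : \det A = A 0 0 * A 1 1 - A 0 1 * A 1 0.
Proof.
rewrite (expand_det_row _ ord0) big_ord_recl big_ord1 /cofactor !det_mx11 !mxE.
rewrite !mul1r mulN1r mulrN; congr (_ * A _ _ - A _ _ * A _ _); exact/val_inj.
Qed.

(** In dimension 2 the single operator K = R(e_0, e_1) determines the curvature, and the rows of the
    Ricci matrix are those of K exchanged, one with a sign. As G K is skew it has one free entry, so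
    K is a multiple of G^-1 J with J the standard skew matrix, and the Ricci matrix is that multiple
    of G. *)
Lemma ricci_surface (R : realType) (G : 'rV[R]_2 -> 'M[R]_2) (V : set 'rV[R]_2) x :
  open V -> (forall i j, smooth_on V (fun x => G x i j)) ->
  (forall x, V x -> (G x)^T = G x) -> (forall x, V x -> G x \in unitmx) -> V x ->
  exists s, ricci_local G x = s *: G x.
Proof.
move=> V_open G_smooth G_sym G_unit Vx.
(* The two indices are made abstract, so that the various representations of the elements of ['I_2]
   do not interfere. *)
have [i0 [i1 [ord2 sum2 det2]]] : exists i0 i1 : 'I_2, [/\ forall i, i = i0 \/ i = i1,
    forall F : 'I_2 -> R, \sum_i F i = F i0 + F i1 &
    forall A : 'M[R]_2, \det A = A i0 i0 * A i1 i1 - A i0 i1 * A i1 i0].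
  exists 0, 1; split; last exact: det22.
    by case=> [[|[|//]] lti]; [left|right]; exact/val_inj.
  by move=> F; rewrite big_ord_recl big_ord1; congr (_ + F _); exact/val_inj.
have ric i j : ricci_local G x i j = \sum_k curvature_mx G k i x k j.
  by rewrite ricci_localE; apply: eq_bigr => k _; rewrite curvature_mxE.
have r0 j : ricci_local G x i0 j = - curvature_mx G i0 i1 x i1 j.
  rewrite ric sum2 curvature_mx_diag [_ i0 j]mxE add0r.
  by rewrite curvature_mxN [LHS]mxE.
have r1 j : ricci_local G x i1 j = curvature_mx G i0 i1 x i0 j.
  by rewrite ric sum2 curvature_mx_diag [_ i1 j]mxE addr0.
have /matrixP skew := curvature_mx_skew V_open G_smooth G_sym G_unit i0 i1 Vx.
move: (curvature_mx G i0 i1 x) r0 r1 skew => K r0 r1 skew.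
have g10 : G x i1 i0 = G x i0 i1 by rewrite -{1}(G_sym x Vx) mxE.
have d0 : G x i0 i0 * G x i1 i1 - G x i0 i1 ^+ 2 != 0.
  by have := G_unit x Vx; rewrite unitmxE unitfE det2 g10 expr2.
have sk i j : G x j i0 * K i0 i + G x j i1 * K i1 i =
    - (G x i i0 * K i0 j + G x i i1 * K i1 j).
  by have := skew i j; rewrite !mxE !sum2.
(* The factor is the free entry of G K over det G, that is the Gaussian curvature. *)
exists ((G x i0 i0 * K i0 i1 + G x i0 i1 * K i1 i1) /
        (G x i0 i0 * G x i1 i1 - G x i0 i1 ^+ 2)).
apply/matrixP => i j; rewrite [RHS]mxE mulrAC; apply: (mulIf d0); rewrite divfK //.
have s00 : G x i0 i0 * K i0 i0 + G x i0 i1 * K i1 i0 = 0 by have := sk i0 i0; lra.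
have s01 := sk i0 i1.
have s11 : G x i0 i1 * K i0 i1 + G x i1 i1 * K i1 i1 = 0.
  by have := sk i1 i1; rewrite g10; lra.
move: s01; rewrite g10 => s01.
case: (ord2 i) => ->; case: (ord2 j) => ->; rewrite ?r0 ?r1 ?g10;
  move: (G x i0 i0) (G x i0 i1) (G x i1 i1) s00 s01 s11 => g00 g01 g11;
  move: (K i0 i0) (K i0 i1) (K i1 i0) (K i1 i1) => k00 k01 k10 k11 s00 s01 s11.
(* Cramer's rule: in each case an entry of K times det G is written through the entries of G K, to
   which the skewness relations apply. *)
- have -> : - k10 * (g00 * g11 - g01 ^+ 2) =
    g01 * (g00 * k00 + g01 * k10) - g00 * (g01 * k00 + g11 * k10) by ring.
  rewrite s00 s01; ring.
- have -> : - k11 * (g00 * g11 - g01 ^+ 2) =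
    g01 * (g00 * k01 + g01 * k11) - g00 * (g01 * k01 + g11 * k11) by ring.
  rewrite s11; ring.
- have -> : k00 * (g00 * g11 - g01 ^+ 2) =
    g11 * (g00 * k00 + g01 * k10) - g01 * (g01 * k00 + g11 * k10) by ring.
  rewrite s00 s01; ring.
- have -> : k01 * (g00 * g11 - g01 ^+ 2) =
    g11 * (g00 * k01 + g01 * k11) - g01 * (g01 * k01 + g11 * k11) by ring.
  rewrite s11; ring.
Qed.

Lemma metric_trace_scale (R : realType) m (G : 'rV[R]_m -> 'M[R]_m) x s :
  (G x)^T = G x -> G x \in unitmx -> metric_trace G x (s *: G x) = s * m%:R.
Proof.
move=> G_sym G_unit; rewrite -(mxtrace1 _ m) -(mulVmx G_unit) /metric_trace mulr_sumr.
apply: eq_bigr => i _; rewrite mxE mulr_sumr; apply: eq_bigr => j _.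
by rewrite mxE -{2}G_sym mxE mulrCA.
Qed.

(** If S = s g, taking traces gives kappa = 2 s. The dimension is given by an equation so that the
    lemma applies to a fibre of dimension n - 2. *)
Lemma einstein_surface (R : realType) m (N : sr_manifold R m) : m = 2%N -> einstein N.
Proof.
move=> m2; subst m; move=> p; rewrite /einstein_at /scalar_curvature.
set G := metric_in N (chart_at p); set x := chart_pt p.
have Vx : cimg (atlas (chart_at p)) x by apply: cmap_cimg; exact: chart_atP.
have G_sym := @Defs.metric_sym _ _ _ N (chart_at p).
have G_unit := @metric_nondeg _ _ _ N (chart_at p).
have [s E] := ricci_surface (@cimg_open _ _ _ (atlas _))
  (metric_smooth N (chart_at p)) G_sym G_unit Vx.
have -> : ricci p = s *: metric_at p by exact: E.
rewrite [metric_trace _ _ _]metric_trace_scale; [|exact: G_sym|exact: G_unit].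
by rewrite mulfK ?pnatr_eq0.
Qed.

(** * Vanishing of the fibre rows of S - t g *)

Lemma rank_usubmx (K : fieldType) m1 m2 n (A : 'M[K]_(m1 + m2, n)) :
  dsubmx A = 0 -> (\rank A <= m1)%N.
Proof.
move=> A0; have -> : A = col_mx 1%:M 0 *m usubmx A.
  by rewrite mul_col_mx mul1mx mul0mx -A0 vsubmxK.
exact: leq_trans (mxrankM_maxr _ _) (rank_leq_row _).
Qed.

(** Passing from the Hessian to T absorbs one gradient term Delta_1 F / (2F), which turns the
    coefficient m2 - 2 of the Ricci formula into m2 - 1. *)
Lemma trT_hessian (R : realType) m (M : sr_manifold R m) (F : M -> R) p :
  trT F p = metric_trace (metric_in M (chart_at p)) (chart_pt p)
              (hessian (metric_in M (chart_at p)) (in_chart_at p F) (chart_pt p))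
            - (2 * F p)^-1 * Delta1 F p.
Proof.
rewrite /Delta1 /gradient_sq /trT /metric_trace mulr_sumr -sumrB.
apply: eq_bigr => a _; rewrite mulr_sumr -sumrB; apply: eq_bigr => b _.
rewrite mxE [X in _ = _ - _ * (_ * X)]mxE.
have -> : in_chart_at p F (chart_pt p) = F p.
  by rewrite /in_chart_at cmapK //; exact: chart_atP.
ring.
Qed.

Section WarpedProductRicci.
Variables (R : realType) (m1 m2 : nat).
Variables (M : sr_manifold R m1) (N : sr_manifold R m2).
Variables (F : M -> R) (F_smooth : smooth_fun F) (F_gt0 : forall p, 0 < F p).
Local Notation P := (warped_product N F_smooth F_gt0).

Let G (z : P) := warped_metric (metric_in M (chart_at z.1)) (metric_in N (chart_at z.2))
  (in_chart_at z.1 F).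

(** This holds by conversion, because the chart selected at a point of the product is the product of
    the charts selected on the factors. *)
Let ricciE (z : P) :
  ricci z = ricci_local (G z) (row_mx (chart_pt z.1) (chart_pt z.2)).
Proof. by []. Qed.

Let metric_atE (z : P) :
  metric_at z = block_mx (metric_at z.1) 0 0 (F z.1 *: metric_at z.2).
Proof.
have -> : metric_at z = G z (row_mx (chart_pt z.1) (chart_pt z.2)) by [].
rewrite /G /warped_metric row_mxKl row_mxKr /in_chart_at cmapK //; exact: chart_atP.
Qed.

(** The mixed block vanishes for every [t]. At an Einstein point of the fibre the other block is a
    multiple of the fibre metric, and the equation for [t] says that the factor is zero. *)
Lemma dsubmx_ricci_warped (z : P) t : einstein_at z.2 ->
  t * F z.1 = scalar_curvature z.2 / m2%:R
    - 2^-1 * (trT F z.1 + (m2%:R - 1) * (2 * F z.1)^-1 * Delta1 F z.1) ->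
  dsubmx (ricci z - t *: metric_at z) = 0.
Proof.
move=> Nz tE; apply/matrixP => a j.
have V1 : cimg (atlas (chart_at z.1)) (chart_pt z.1) by apply: cmap_cimg; exact: chart_atP.
have V2 : cimg (atlas (chart_at z.2)) (chart_pt z.2) by apply: cmap_cimg; exact: chart_atP.
have F0 u : cimg (atlas (chart_at z.1)) u -> in_chart_at z.1 F u != 0.
  by move=> _; exact: lt0r_neq0 (F_gt0 _).
have oM := @cimg_open _ _ _ (atlas (chart_at z.1)).
have oN := @cimg_open _ _ _ (atlas (chart_at z.2)).
have sM := metric_smooth M (chart_at z.1).
have sN := metric_smooth N (chart_at z.2).
have symM := @Defs.metric_sym _ _ _ M (chart_at z.1).
have symN := @Defs.metric_sym _ _ _ N (chart_at z.2).
have unM := @metric_nondeg _ _ _ M (chart_at z.1).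
have unN := @metric_nondeg _ _ _ N (chart_at z.2).
have sF : smooth_on (cimg (atlas (chart_at z.1))) (in_chart_at z.1 F) by exact: F_smooth.
rewrite [LHS]mxE [LHS]mxE [X in _ + X]mxE [X in _ - X]mxE [RHS]mxE metric_atE ricciE.
case: (split_ordP j) => b ->.
  rewrite block_mxEdl [X in _ * X]mxE mulr0 subr0.
  rewrite (ricci_warped_rl oM oN symM unM sN symN unN sF F0) //.
    by rewrite row_mxKl.
  by rewrite row_mxKr.
rewrite block_mxEdr [X in _ * X]mxE.
rewrite (ricci_warped_rr oM oN sM symM unM sN symN unN sF F0);
  rewrite ?row_mxKl ?row_mxKr //.
have -> : ricci_local (metric_in N (chart_at z.2)) (chart_pt z.2) = ricci z.2 by [].
rewrite Nz mxE mulrA tE trT_hessian /Delta1.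
have -> : in_chart_at z.1 F (chart_pt z.1) = F z.1.
  by rewrite /in_chart_at cmapK //; exact: chart_atP.
rewrite -/(metric_at z.2); ring.
Qed.

End WarpedProductRicci.

(** * The rank bound and the 2-quasi-Einstein property *)

Theorem theorem6p1 (R : realType) (n : nat) (n_ge4 : (4 <= n)%N)
    (M : sr_manifold R 2) (N : sr_manifold R (n - 2))
    (F : M -> R) (F_smooth : smooth_fun F) (F_gt0 : forall p : M, 0 < F p)
    (N_einstein : (5 <= n)%N -> einstein N) :
  let P := warped_product N F_smooth F_gt0 in
  (forall z : P, U_S P z ->
     (\rank (ricci z - tau1 F z *: metric_at z)%R <= 2)%N) /\
  ((exists W : set P, [/\ open W, W !=set0, W `<=` U_S P &
      forall z : P, W z -> \rank (ricci z - tau1 F z *: metric_at z)%R = 2%N]) ->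
   two_quasi_einstein P).
Proof.
move=> P.
(* For n = 4 the fibre is a surface, hence Einstein. *)
have N_ein : einstein N.
  have [n5|] := leqP 5 n; first exact: N_einstein.
  by rewrite ltnS => n4; apply: einstein_surface; rewrite (@anti_leq n 4) // n4.
have rk (z : P) : (\rank (ricci z - tau1 F z *: metric_at z)%R <= 2)%N.
  apply: rank_usubmx; apply: dsubmx_ricci_warped => //.
  rewrite /tau1; have F0 : F z.1 != 0 by rewrite gt_eqF.
  have n2 : (n - 2)%:R != 0 :> R by rewrite pnatr_eq0 subn_eq0 -ltnNge (leq_trans _ n_ge4).
  (* Subtraction on [nat] is truncated; n >= 4 makes it agree with the real one, so that n - 3
     matches m2 - 1. *)
  have -> : (n - 3)%:R = (n - 2)%:R - 1 :> R.
    by rewrite -[1]/(1%:R) -natrB ?subn_gt0 ?(leq_trans _ n_ge4) // -subnDA.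
  by field; rewrite n2 F0.
split=> // -[W [oW W0 WU WE]]; split; first by rewrite subnKC ?(leq_trans _ n_ge4).
by exists (tau1 F); split=> // ; exists W.
Qed.
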